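(* Let $k\ge 2$, $n\ge k$, and let $c=(c_1,\dots,c_k)\in\mathbb R^k$ with $c_1\ge\dots\ge c_k$ and not all $c_i$ equal. Let $\Phi:M_n(\mathbb C)\to M_n(\mathbb C)$ be a surjective map. Then $W_c(\Phi(A)\Phi(B))=W_c(AB)$ for all $A,B\in M_n(\mathbb C)$ if and only if $\Phi$ has one of the following forms: (i) When $c_1+c_k\neq 0$: there are a unitary matrix $U\in M_n(\mathbb C)$ and a sign $\varepsilon\in\{1,-1\}$ such that $\Phi(A)=\varepsilon UAU^*$ for all $A\in M_n(\mathbb C)$. (ii) When there exists an integer $p$ with $1<p<k$ such that $c_p+c_{k+1-p}\neq 0$ and $c_j+c_{k+1-j}=0$ for $j=1,\dots,p-1$: there are a unitary matrix $U\in M_n(\mathbb C)$ and functions $\phi:\mathcal T\to\{-1,1\}$ and $\phi':M_n(\mathbb C)\to\{-1,1\}$ satisfying $\phi'(A)\phi'(B)\in \mathrm{sgn}(AB)$ for all $A,B\in M_n(\mathbb C)$, such that $$\Phi(A)=\begin{cases}\phi(A)\,UAU^* & \text{if } A\in\mathcal T,\\ \phi'(A)\,UAU^* & \text{if } A\in\mathcal S\setminus\mathcal T,\\ \pm UAU^* & \text{if } A\in M_n(\mathbb C)\setminus\mathcal S,\end{cases}$$ for all $A\in M_n(\mathbb C)$, where the sign $\pm$ in the last line is one fixed sign, the same for all $A\in M_n(\mathbb C)\setminus\mathcal S$. (iii) When $c_j+c_{k+1-j}=0$ for $j=1,\dots,k$: there are a unitary matrix $U\in M_n(\mathbb C)$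 and a function $g:M_n(\mathbb C)\to\{1,-1\}$ such that either $\Phi(A)=g(A)UAU^*$ for all $A\in M_n(\mathbb C)$, or $\Phi(A)=i\,g(A)UAU^*$ for all $A\in M_n(\mathbb C)$.
   Context: $M_n(\mathbb C)$ is the algebra of complex $n\times n$ matrices, acting on $\mathbb C^n$ with its standard inner product. For $c=(c_1,\dots,c_k)\in\mathbb R^k$ with $k\le n$, the $c$-numerical range of $A\in M_n(\mathbb C)$ is $W_c(A)=\{\sum_{j=1}^k c_j\langle Ae_j,e_j\rangle:\{e_1,\dots,e_k\}\text{ an orthonormal subset of }\mathbb C^n\}$. Let $\mathcal S=\{A\in M_n(\mathbb C): W_c(A)=-W_c(A)\}$ (matrices with symmetric $c$-numerical range) and $\mathcal T=\{A\in\mathcal S: AB\in\mathcal S\text{ and }BA\in\mathcal S\text{ for every }B\in M_n(\mathbb C)\}$. For a matrix $C$, $\mathrm{sgn}(C)$ denotes the set $\{1\}$ if $C\notin\mathcal S$ and the set $\{-1,1\}$ if $C\in\mathcal S$.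
   Formalization: In (ii) the fixed sign ± on matrices outside S is required to equal the value of φ' there; with an unrelated sign the ''if'' direction fails, e.g. n=k=3, c=(1,1/2,-1), φ=φ'=1, U=I, sign -1, tested on diag(1,0,-1) and diag(1,1,-1). *)

(* Defs.v *)
From mathcomp Require Import all_boot all_order all_algebra.
From mathcomp Require Import boolp classical_sets functions reals.
From mathcomp Require Export complex.

Set Implicit Arguments.
Unset Strict Implicit.
Unset Printing Implicit Defensive.

Import Order.TTheory GRing.Theory Num.Theory.
Local Open Scope ring_scope.
Local Open Scope sesquilinear_scope.
Local Open Scope complex_scope.
Local Open Scope classical_set_scope.

Section CNumericalRange.
Variables (R : realType) (k n : nat).
Local Notation C := R[i].
Implicit Types (c : k.-tuple R) (A B : 'M[C]_n) (W : set C).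

(* 1-based coefficient c_j, meaningful for 1 <= j <= k. *)
Definition coef c (j : nat) : R := nth 0 c j.-1.

Definition inner (x y : 'cV[C]_n) : C := \sum_(i < n) x i 0 * Num.conj (y i 0).

Definition orthonormal_family (e : 'I_k -> 'cV[C]_n) : Prop :=
  forall i j, inner (e i) (e j) = (i == j)%:R.

Definition cnumrange c A : set C :=
  [set \sum_(j < k) (tnth c j)%:C * inner (A *m e j) (e j)
     | e in orthonormal_family].

Definition symm c : set 'M[C]_n :=
  [set A | cnumrange c A = [set - z | z in cnumrange c A]].

Definition symm_mul c : set 'M[C]_n :=
  [set A | symm c A /\ forall B, symm c (A *m B) /\ symm c (B *m A)].

Definition signs : set C := [set 1; -1].

Definition sgn c A : set C := if A \in symm c then signs else [set 1].

Definition form_i (Phi : 'M[C]_n -> 'M[C]_n) : Prop :=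
  exists U : 'M[C]_n, exists eps : C,
    [/\ U \is unitarymx, signs eps &
        forall A, Phi A = eps *: (U *m A *m U ^t*)].

(* The sign eps used off [symm c] is the value that phi' takes there: if eps
   were unrelated to phi', then for n = k = 3 and c = (1, 1/2, -1) the map equal
   to A on [symm c] and to - A off it would be of this form (phi = phi' = 1),
   although it does not preserve the c-numerical range of the product of
   diag(1, 0, -1) and diag(1, 1, -1). *)
Definition form_ii c (Phi : 'M[C]_n -> 'M[C]_n) : Prop :=
  exists U : 'M[C]_n, exists phi phi' : 'M[C]_n -> C, exists eps : C,
    [/\ U \is unitarymx,
        [/\ forall A, symm_mul c A -> signs (phi A),
            forall A, signs (phi' A) & signs eps],
        forall A B, sgn c (A *m B) (phi' A * phi' B),
        forall A, ~ symm c A -> phi' A = eps &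
        forall A,
          [/\ symm_mul c A ->
                Phi A = phi A *: (U *m A *m U ^t*),
              symm c A -> ~ symm_mul c A ->
                Phi A = phi' A *: (U *m A *m U ^t*) &
              ~ symm c A ->
                Phi A = eps *: (U *m A *m U ^t*)]].

Definition form_iii (Phi : 'M[C]_n -> 'M[C]_n) : Prop :=
  exists U : 'M[C]_n, exists g : 'M[C]_n -> C,
    [/\ U \is unitarymx, forall A, signs (g A) &
        (forall A, Phi A = g A *: (U *m A *m U ^t*)) \/
        (forall A, Phi A = ('i * g A) *: (U *m A *m U ^t*))].

End CNumericalRange.

(* Main.v *)
Require Import Defs.
From mathcomp Require Import all_boot all_order all_fingroup all_algebra.
From mathcomp Require Import boolp classical_sets functions reals.
From mathcomp Require Import lra ring.

(** The proof reads two things off a c-numerical range and shows that they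
    already determine [Phi] up to a unitary similarity, a common factor and signs.

    First, pad c with zeros to a real diagonal matrix of size n; then the
    range of X is the set of all traces tr(diag(d) V X V^* ), V unitary.  It is
    a single point exactly when X is scalar ([wrange_subsingleton]).  Hence
    [Phi] preserves whether AB is scalar, from which one recovers, in
    turn, the zero matrix, the invertible matrices, the relation AB = 0, the
    inclusion of row spaces and the matrices of rank one ([preserver_rank1]).

    Secondly, if X has rank at most one, the maximum of the real part of the
    range is explicit in q = tr X and the Frobenius norm ([top_re_ub],
    [top_re_attained]): the range is an elliptical disc with center
    (d_max + d_min) q / 2.  Comparing the maxima in several directions gives
    q^2 and the Frobenius norm ([wrange_eq_invariants]), and q itself when
    d_max + d_min <> 0.  So for B of rank one, AB and Phi(A)Phi(B) have the same
    squared trace and the same Frobenius norm.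

    These invariants suffice ([rank1_test_preserver_form]).  The equality case
    of the Cauchy-Schwarz inequality shows that [Phi] maps the diagonal matrix
    units to unimodular multiples of the projections on an orthonormal basis;
    after a unitary similarity, testing A against matrix units shows that [Phi]
    preserves the moduli of the entries.  A diagonal unitary similarity then
    turns the image of the all-ones matrix into w times itself, with w^4 = 1.
    The equality case of the triangle inequality transfers this, up to sign, to
    every rank one matrix with positive entries, and testing a general A
    against the matrices (t^(ni+j)), t = 1, 2, ..., gives a product of two
    polynomials that vanishes at all positive integers; one factor is zero, which
    says that Phi(A) = w A or Phi(A) = - w A.  Altogether
    Phi(A) = w g(A) U A U^*, with signs g(A).

    It remains to see when signs matter.  Whenever the range of AB is not
    symmetric, w^2 g(A) g(B) = 1 ([sign_of_nonsymm]).  If c_1 + c_k <> 0, rank one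
    matrices with nonzero trace have a nonsymmetric range, which forces g to be
    constant and w^2 = 1; if c is not antisymmetric, the range of diag(d) is not
    symmetric, which forces w^2 = 1 because diag(d) is a square; and if c is
    antisymmetric, all ranges are symmetric and the two values w^2 = 1 and
    w^2 = -1 give the two alternatives. *)

Set Implicit Arguments.
Unset Strict Implicit.
Unset Printing Implicit Defensive.

Import Order.TTheory GRing.Theory Num.Theory.
Local Open Scope ring_scope.
Local Open Scope sesquilinear_scope.
Local Open Scope complex_scope.
Local Open Scope classical_set_scope.

(** * Adjoints and c-numerical ranges *)

Section Adjoint.
Variable F : numClosedFieldType.

Lemma ctrmxM m n p (A : 'M[F]_(m, n)) (B : 'M[F]_(n, p)) :
  (A *m B)^t* = B^t* *m A^t*.
Proof. by rewrite trmx_mul map_mxM. Qed.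

Lemma ctrmxD m n (A B : 'M[F]_(m, n)) : (A + B)^t* = A^t* + B^t*.
Proof. by rewrite linearD map_mxD. Qed.

Lemma ctrmxB m n (A B : 'M[F]_(m, n)) : (A - B)^t* = A^t* - B^t*.
Proof. by rewrite linearB map_mxB. Qed.

Lemma ctrmxZ m n a (A : 'M[F]_(m, n)) : (a *: A)^t* = Num.conj a *: A^t*.
Proof. by rewrite linearZ map_mxZ. Qed.

Lemma unitarymx_mulVK n (U : 'M[F]_n) : U \is unitarymx -> U^t* *m U = 1%:M.
Proof. by move=> hU; rewrite -[_ *m U]mul1mx mulmxA mulmxKtV. Qed.

Lemma unitarymx_ctr n (U : 'M[F]_n) : U \is unitarymx -> U^t* \is unitarymx.
Proof. by rewrite trmxC_unitary. Qed.

Lemma conj_mulmx n (U A B : 'M[F]_n) : U \is unitarymx ->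
  (U *m A *m U^t*) *m (U *m B *m U^t*) = U *m (A *m B) *m U^t*.
Proof.
by move=> hU; rewrite !mulmxA -(mulmxA _ (U^t*) U) unitarymx_mulVK // mulmx1.
Qed.

Lemma conj_comp n (V U A : 'M[F]_n) :
  V *m (U *m A *m U^t*) *m V^t* = (V *m U) *m A *m (V *m U)^t*.
Proof. by rewrite ctrmxM !mulmxA. Qed.

Lemma conj_uncomp n (V U A : 'M[F]_n) : U \is unitarymx ->
  V *m U^t* *m (U *m A *m U^t*) *m (V *m U^t*)^t* = V *m A *m V^t*.
Proof.
move=> hU; rewrite ctrmxM trmxCK !mulmxA.
by rewrite -!(mulmxA _ (U^t*) U) unitarymx_mulVK // !mulmx1.
Qed.

Lemma perm_mx_unitary n (s : {perm 'I_n}) : (perm_mx s : 'M[F]_n) \is unitarymx.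
Proof.
apply/unitarymxP; rewrite tr_perm_mx map_perm_mx -perm_mxM.
by rewrite mulgV perm_mx1.
Qed.

(** A Gram-Schmidt basis of the orthogonal complement of the rows supplies the
    missing rows. *)
Lemma unitary_extend m n (M : 'M[F]_(m, n)) (hmn : (m <= n)%N) :
  M \is unitarymx ->
  exists2 V : 'M_n, V \is unitarymx & forall i j, V (widen_ord hmn i) j = M i j.
Proof.
move=> hM; pose N := orthomx Num.conj (mx_of_hermitian (@hermitian1mx F n)) M.
pose r := \rank N; pose B := schmidt (row_base N).
have hB : B \is unitarymx by apply: schmidt_unitarymx; apply: rank_leq_col.
have hMB : M *m B^t* = 0.
  apply/eqP; rewrite -orthomx1E orthomx_sym /B.
  rewrite (eqmx_schmidt_free (row_base_free _)) eq_row_base.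
  exact: submx_refl.
have E : (m + r)%N = n by rewrite /r /N rank_ortho mxrank_unitary // subnKC.
move: (B) hB hMB; rewrite -/r => {}B hB hMB.
have hBM : B *m M^t* = 0.
  by have := congr1 (fun X => X^t*) hMB; rewrite ctrmxM trmxCK trmx0 map_mx0.
exists (castmx (E, erefl n) (col_mx M B)); last first.
  move=> i j; rewrite castmxE /= cast_ord_id -[RHS](col_mxEu M B).
  by congr (col_mx M B _ j); apply: val_inj.
move: hB hMB hBM; clearbody r => {N}; move: B; move: r E => s E B hB hMB hBM.
case: n / E hmn M hM B hB hMB hBM => hmn M hM B hB hMB hBM; rewrite castmx_id.
apply/unitarymxP; rewrite tr_col_mx map_row_mx mul_col_row hMB hBM.
by rewrite (unitarymxP hM) (unitarymxP hB) -scalar_mx_block.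
Qed.

End Adjoint.

Section Range.
Variables (R : rcfType) (n : nat).
Local Notation C := R[i].
Implicit Types (d : 'I_n -> R) (X Y U V : 'M[C]_n).

(** The trace of diag(d) X. *)
Definition wtrace d X : C := \sum_i (d i)%:C * X i i.

(** The c-numerical range, with the orthonormal families replaced by unitary
    matrices so that all n diagonal entries can be used. *)
Definition wrange d X : set C :=
  [set wtrace d (V *m X *m V^t*) | V in [set V | V \is unitarymx]].

Lemma wtraceZ d a X : wtrace d (a *: X) = a * wtrace d X.
Proof.
by rewrite /wtrace mulr_sumr; apply: eq_bigr => i _; rewrite mxE mulrCA.
Qed.

Lemma wrange_conj d U X : U \is unitarymx ->
  wrange d (U *m X *m U^t*) = wrange d X.
Proof.
move=> hU; apply/seteqP; split=> z [V /= hV <-].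
  by exists (V *m U); [exact: mul_unitarymx hV hU | rewrite -conj_comp].
exists (V *m U^t*); first exact: mul_unitarymx hV (unitarymx_ctr hU).
by rewrite (conj_uncomp _ _ hU).
Qed.

Lemma wrangeZ_sub d a X z : wrange d X z -> wrange d (a *: X) (a * z).
Proof.
by case=> V hV <-; exists V => //; rewrite -scalemxAr -scalemxAl wtraceZ.
Qed.

Lemma wrangeZ d a X : wrange d (a *: X) = [set a * z | z in wrange d X].
Proof.
apply/seteqP; split=> z.
  case=> V hV <-; exists (wtrace d (V *m X *m V^t*)); first by exists V.
  by rewrite -scalemxAr -scalemxAl wtraceZ.
by case=> w /(wrangeZ_sub a) hw <-.
Qed.

Lemma wrange_eqZ d a X Y :
  wrange d X = wrange d Y -> wrange d (a *: X) = wrange d (a *: Y).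
Proof. by rewrite !wrangeZ => ->. Qed.

End Range.

Section Padding.
Variables (R : realType) (k n : nat) (hn : (k <= n)%N).
Implicit Types (c : k.-tuple R) (A : 'M[R[i]]_n).

Definition padded c (i : 'I_n) : R := nth 0 c i.

(** A family (e_j) corresponds to a unitary matrix with first rows e_j^*; the
    remaining rows have weight zero, so they do not contribute. *)
Lemma cnumrange_padded c A : cnumrange c A = wrange (padded c) A.
Proof.
have sumE (f : 'I_n -> R[i]) :
    \sum_i (padded c i)%:C * f i = \sum_j (tnth c j)%:C * f (widen_ord hn j).
  rewrite (bigID (fun i : 'I_n => (i < k)%N)) /= addrC big1 ?add0r.
    rewrite (big_ord_narrow hn); apply: eq_bigr => j _.
    by rewrite /padded /= (tnth_nth 0).
  move=> i; rewrite -leqNgt => ki.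
  by rewrite /padded nth_default ?size_tuple // mul0r.
have innerE (M : 'M[R[i]]_n) (x : 'cV_n) :
    inner (M *m x) x = (x^t* *m M *m x) 0 0.
  by rewrite -mulmxA mxE /inner; apply: eq_bigr => l _; rewrite !mxE mulrC.
apply/seteqP; split=> z.
  case=> e he <-; pose M := \matrix_(j < k) (e j)^t*.
  have hM : M \is unitarymx.
    apply/unitarymxP/matrixP => i j; rewrite !mxE.
    rewrite -[RHS]conjCK conjC_nat -(he i j) /inner rmorph_sum /=.
    apply: eq_bigr => l _; rewrite !mxE /= rmorphM /= conjCK //.
  have [V hV VM] := unitary_extend hn hM.
  exists V => //; rewrite /wtrace sumE; apply: eq_bigr => j _; congr (_ * _).
  rewrite innerE !mxE; apply: eq_bigr => l _; rewrite !mxE VM !mxE conjCK.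
  congr (_ * _); apply: eq_bigr => p _; rewrite VM !mxE //.
case=> V /= hV <-.
exists (fun j => (row (widen_ord hn j) V)^t*).
  move=> i j; have /matrixP/(_ (widen_ord hn j) (widen_ord hn i)) := unitarymxP hV.
  rewrite !mxE -val_eqE /= eq_sym => <-; apply: eq_bigr => l _.
  by rewrite !mxE conjCK mulrC.
rewrite /wtrace sumE; apply: eq_bigr => j _; congr (_ * _).
rewrite innerE trmxCK -row_mul mxE [RHS]mxE; apply: eq_bigr => l _.
by rewrite !mxE.
Qed.

End Padding.

(** * Diagonalization; ranges reduced to a point *)

Section Diagonalization.
Variable R : rcfType.
Local Notation C := R[i].

Lemma conj_perm_mxE n (s : {perm 'I_n}) (Y : 'M[C]_n) i j :
  (perm_mx s *m Y *m (perm_mx s)^t*) i j = Y (s i) (s j).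
Proof.
by rewrite tr_perm_mx map_perm_mx -col_permE -row_permE !mxE.
Qed.

Lemma perm_two_points (T : finType) (x0 x1 x y : T) : x0 != x1 -> x != y ->
  exists s : {perm T}, s x0 = x /\ s x1 = y.
Proof.
move=> x01 xy; exists (tperm x0 x * tperm (tperm x0 x x1) y)%g.
rewrite !permM tpermL; split; last by rewrite tpermL.
rewrite tpermD // 1?eq_sym // -[X in X != _](tpermL x0 x).
by rewrite (inj_eq perm_inj).
Qed.

Lemma hermitian_diagonalization n (H : 'M[C]_n) : H^t* = H ->
  exists2 P : 'M[C]_n, P \is unitarymx &
    exists s : 'I_n -> R, P *m H *m P^t* = \matrix_(i, j) ((s i)%:C *+ (i == j)).
Proof.
move=> hH; have hH' : H \is hermsymmx.
  by apply/is_hermitianmxP; rewrite expr0 scale1r hH.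
have /orthomx_spectralP E := hermitian_normalmx hH'.
have hP := spectral_unitarymx H.
exists (spectralmx H) => //.
exists (fun i => complex.Re (spectral_diag H 0 i)).
rewrite [X in _ *m X *m _]E !mulmxA mulmxV ?spectral_unit // mul1mx.
rewrite mulmxtVK //; apply/matrixP => i j; rewrite !mxE.
rewrite RRe_real //.
by have /mxOverP := hermitian_spectral_diag_real hH'; apply.
Qed.

(** The matrix is a combination of two Hermitian matrices that inherit the
    hypothesis; applied to a diagonalizing unitary matrix it says that their
    eigenvalues vanish. *)
Lemma zero_diagonals_eq0 n (Z : 'M[C]_n) :
  (forall V : 'M[C]_n, V \is unitarymx -> forall i, (V *m Z *m V^t*) i i = 0) ->
  Z = 0.
Proof.
move=> hZ.
have adj0 (V : 'M[C]_n) i : V \is unitarymx -> (V *m Z^t* *m V^t*) i i = 0.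
  move=> hV; have -> : V *m Z^t* *m V^t* = (V *m Z *m V^t*)^t*.
    by rewrite !ctrmxM trmxCK mulmxA.
  by rewrite 2!mxE hZ // conjC0.
have herm0 (H : 'M[C]_n) : H^t* = H ->
    (forall V : 'M[C]_n, V \is unitarymx -> forall i, (V *m H *m V^t*) i i = 0) ->
    H = 0.
  move=> /hermitian_diagonalization [P hP [s E]] H0.
  have D0 : P *m H *m P^t* = 0.
    rewrite E; apply/matrixP => i j; rewrite !mxE.
    by have := H0 P hP i; rewrite E mxE eqxx mulr1n => ->; rewrite mul0rn.
  rewrite -[H]mul1mx -[H]mulmx1 -(unitarymx_mulVK hP) !mulmxA.
  by rewrite -(mulmxA _ P H) -(mulmxA _ (P *m H)) D0 mulmx0 mul0mx.
have S0 : Z + Z^t* = 0.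
  apply: herm0; first by rewrite ctrmxD trmxCK addrC.
  by move=> V hV i; rewrite mulmxDr mulmxDl mxE hZ // adj0 // addr0.
have D0 : 'i *: (Z - Z^t*) = 0 :> 'M[C]_n.
  apply: herm0.
    by rewrite ctrmxZ conjCi ctrmxB trmxCK scaleNr -scalerN opprB.
  move=> V hV i; rewrite -scalemxAr -scalemxAl mulmxBr mulmxBl mxE [X in 'i * X]mxE [X in _ + X]mxE.
  by rewrite hZ // adj0 // subr0 mulr0.
have : (2%:R : C) *: Z = 0.
  have Z' : Z - Z^t* = 0.
    by apply/eqP; move/eqP: D0; rewrite scaler_eq0 (negbTE (neq0Ci _)).
  by rewrite scaler_nat mulr2n -[RHS](addr0 0) -{1}S0 -Z' addrACA addrN addr0.
by move/eqP; rewrite scaler_eq0 pnatr_eq0 /= => /eqP.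
Qed.

End Diagonalization.

Section Constant.
Variables (R : rcfType) (n : nat) (d : 'I_n -> R) (i0 i1 : 'I_n).
Hypothesis d01 : d i0 != d i1.
Local Notation C := R[i].
Implicit Types X V : 'M[C]_n.

Lemma wrange_permute V X (s : {perm 'I_n}) : V \is unitarymx ->
  wrange d X (\sum_i (d i)%:C * (V *m X *m V^t*) (s i) (s i)).
Proof.
move=> hV; exists (perm_mx s *m V).
  exact: mul_unitarymx (perm_mx_unitary _ s) hV.
apply: eq_bigr => i _; congr (_ * _).
by rewrite -conj_comp conj_perm_mxE.
Qed.

Lemma wrange_scalar (a : C) : wrange d a%:M = [set (\sum_i (d i)%:C) * a].
Proof.
apply/seteqP; split=> z; last first.
  move=> ->; exists 1%:M; first by apply/unitarymxP; rewrite trmx1 map_mx1 mulmx1.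
  rewrite trmx1 map_mx1 mulmx1 mul1mx /wtrace mulr_suml.
  by apply: eq_bigr => i _; rewrite mxE eqxx.
case=> V /= hV <-; rewrite mul_mx_scalar -scalemxAl (unitarymxP hV).
by rewrite /wtrace mulr_suml; apply: eq_bigr => i _; rewrite !mxE eqxx mulr1.
Qed.

(** Exchanging two vectors that carry distinct weights must not change the
    value, so all diagonal entries of V X V^* agree, for every unitary V; then
    X - (tr X / n) has zero diagonal in every orthonormal basis. *)
Lemma wrange_subsingleton X :
  (forall z w, wrange d X z -> wrange d X w -> z = w) <-> exists a : C, X = a%:M.
Proof.
split=> [hX|[a ->] z w]; last by rewrite wrange_scalar => -> ->.
have i01 : i0 != i1 by apply: contraNneq d01 => ->.
have same0 V : V \is unitarymx -> (V *m X *m V^t*) i0 i0 = (V *m X *m V^t*) i1 i1.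
  move=> hV; set Y := V *m X *m V^t*.
  have := hX _ _ (wrange_permute X 1%g hV) (wrange_permute X (tperm i0 i1) hV).
  rewrite -/Y (bigD1 i0) //= (bigD1 i1) 1?eq_sym //=.
  rewrite [RHS](bigD1 i0) //= [X in _ = _ + X -> _](bigD1 i1) 1?eq_sym //=.
  rewrite !perm1 tpermL tpermR !addrA.
  under eq_bigr do rewrite perm1.
  under [X in _ = _ + X]eq_bigr => i /andP[h0 h1].
    by rewrite tpermD 1?eq_sym //; over.
  move/addIr/eqP; rewrite -subr_eq0.
  rewrite (_ : _ - _ = ((d i0)%:C - (d i1)%:C) * (Y i0 i0 - Y i1 i1)); last by ring.
  rewrite mulf_eq0 -rmorphB /= => /orP[/eqP/complexI/eqP|].
    by rewrite subr_eq0 (negbTE d01).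
  by rewrite subr_eq0 => /eqP.
have same V i j : V \is unitarymx -> (V *m X *m V^t*) i i = (V *m X *m V^t*) j j.
  move=> hV; have [->//|ij] := eqVneq i j.
  have [s [<- <-]] := perm_two_points i01 ij.
  have := same0 _ (mul_unitarymx (perm_mx_unitary _ s) hV).
  by rewrite -conj_comp (conj_perm_mxE s _ i0) (conj_perm_mxE s _ i1).
have n0 : (n%:R : C) != 0 by rewrite pnatr_eq0 -lt0n (leq_ltn_trans _ (ltn_ord i0)).
exists (\tr X / n%:R); apply/eqP; rewrite -subr_eq0; apply/eqP.
apply: zero_diagonals_eq0 => V hV i; rewrite mulmxBr mulmxBl mul_mx_scalar.
rewrite -scalemxAl (unitarymxP hV) mxE [X in _ + X]mxE [X in - X]mxE.
rewrite [1%:M _ _]mxE eqxx mulr1; apply/eqP; rewrite subr_eq0.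
apply/eqP; apply: (mulIf n0); rewrite divfK //.
have -> : \tr X = \tr (V *m X *m V^t*).
  by rewrite mxtrace_mulC mulmxA unitarymx_mulVK // mul1mx.
rewrite /mxtrace (eq_bigr (fun=> (V *m X *m V^t*) i i)); last first.
  by move=> j _; apply: same.
by rewrite sumr_const card_ord mulr_natr.
Qed.

End Constant.

(** * Frobenius norms and matrices of rank one *)

Section RankOneSupport.
Variable R : rcfType.
Local Notation C := R[i].
Local Notation Re := (@complex.Re R).
Local Notation Im := (@complex.Im R).

Lemma ReD (x y : C) : Re (x + y) = Re x + Re y. Proof. by case: x y => a b []. Qed.
Lemma ImD (x y : C) : Im (x + y) = Im x + Im y. Proof. by case: x y => a b []. Qed.

Lemma Re_sum I (r : seq I) (P : pred I) (f : I -> C) :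
  Re (\sum_(i <- r | P i) f i) = \sum_(i <- r | P i) Re (f i).
Proof. by apply: (big_morph Re ReD). Qed.

Lemma Im_sum I (r : seq I) (P : pred I) (f : I -> C) :
  Im (\sum_(i <- r | P i) f i) = \sum_(i <- r | P i) Im (f i).
Proof. by apply: (big_morph Im ImD). Qed.

Lemma mxtrace_ctrmx m (A : 'M[C]_m) : \tr (A^t*) = Num.conj (\tr A).
Proof.
by rewrite /mxtrace rmorph_sum; apply: eq_bigr => l _; rewrite mxE [_^T _ _]mxE.
Qed.

Lemma Re_realM (a : R) (z : C) : Re (a%:C * z) = a * Re z.
Proof. by case: z => x y /=; rewrite mul0r subr0. Qed.

(** The squared Frobenius norm. *)
Definition frob m n (A : 'M[C]_(m, n)) : C := \tr (A *m A^t*).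

Lemma frobE m n (A : 'M[C]_(m, n)) :
  frob A = \sum_i \sum_j `|A i j| ^+ 2.
Proof.
apply: eq_bigr => i _; rewrite mxE; apply: eq_bigr => j _.
by rewrite !mxE normCK.
Qed.

Lemma frob_ge0 m n (A : 'M[C]_(m, n)) : 0 <= frob A.
Proof. by rewrite frobE; do 2!apply: sumr_ge0 => ? _; rewrite exprn_ge0. Qed.

Lemma frob_eq0 m n (A : 'M[C]_(m, n)) : frob A = 0 -> A = 0.
Proof.
rewrite frobE => /eqP; rewrite psumr_eq0 => [/allP h|i _]; last first.
  by apply: sumr_ge0 => j _; rewrite exprn_ge0.
apply/matrixP => i j; have := h i (mem_index_enum _).
rewrite psumr_eq0 /= => [/allP/(_ j (mem_index_enum _))|l _]; last first.
  by rewrite exprn_ge0.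
by rewrite sqrf_eq0 normr_eq0 mxE => /eqP.
Qed.

Lemma frob_delta m n i j : frob (delta_mx i j : 'M[C]_(m, n)) = 1.
Proof.
rewrite /frob trmx_delta map_delta_mx mul_delta_mx /mxtrace (bigD1 i) //= big1.
  by rewrite mxE !eqxx addr0.
by move=> k ki; rewrite mxE (negbTE ki).
Qed.

Lemma frob_real m n (A : 'M[C]_(m, n)) : frob A = (Re (frob A))%:C.
Proof. by rewrite RRe_real // ger0_real // frob_ge0. Qed.

Lemma frob_outer n (u : 'cV[C]_n) (v : 'rV[C]_n) :
  frob (u *m v) = frob u * frob v.
Proof.
rewrite !frobE big_ord1 mulr_suml; apply: eq_bigr => i _.
rewrite big_ord1 mulr_sumr; apply: eq_bigr => j _.
by rewrite mxE big_ord1 normrM exprMn.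
Qed.

Lemma trace_outer n (u : 'cV[C]_n) (v : 'rV[C]_n) :
  \tr (u *m v) = \sum_i u i 0 * v 0 i.
Proof. by apply: eq_bigr => i _; rewrite mxE big_ord1. Qed.

Lemma mxtrace_outer_sqr n (u : 'cV[C]_n) (v : 'rV[C]_n) :
  \tr (u *m v *m (u *m v)) = \tr (u *m v) ^+ 2.
Proof.
rewrite mulmxA -(mulmxA u v u) mxtrace_mulC !mulmxA -(mulmxA (v *m u)).
by rewrite (mxtrace_mulC u v) /mxtrace !big_ord1 mxE big_ord1 expr2.
Qed.

(** The Cauchy-Schwarz inequality for the vectors of moduli. *)
Lemma sum_norm_outer n (u : 'cV[C]_n) (v : 'rV[C]_n) :
  (\sum_i `|u i 0 * v 0 i|) ^+ 2 <= frob (u *m v).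
Proof.
pose x := \row_i `|u i 0|; pose y := \row_i `|v 0 i|.
have : `|dotmx x y| ^+ 2 <= dotmx x x * dotmx y y.
  exact: (CauchySchwarz (@dotmx C n) x y).1.
have -> : dotmx x y = \sum_i `|u i 0 * v 0 i|.
  rewrite dotmxE mxE; apply: eq_bigr => i _.
  by rewrite !mxE normrM conj_normC.
rewrite ger0_norm; last by apply: sumr_ge0.
congr (_ <= _); rewrite frob_outer !frobE big_ord1 !dotmxE !mxE.
congr (_ * _); apply: eq_bigr => i _; rewrite !mxE conj_normC ?big_ord1 //.
Qed.

(** The triangle inequality for the numbers |Re p_i| + i Im p_i, whose moduli
    are those of the p_i = u_i v_i. *)
Lemma sum_Re_outer n (u : 'cV[C]_n) (v : 'rV[C]_n) :
  (\sum_i `|Re (u i 0 * v 0 i)|) ^+ 2 + Im (\tr (u *m v)) ^+ 2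
    <= Re (frob (u *m v)).
Proof.
pose p i := u i 0 * v 0 i.
rewrite -lecR -frob_real; apply: le_trans (sum_norm_outer u v).
pose T := \sum_i (`|Re (p i)| +i* Im (p i)).
have -> : (\sum_i `|Re (p i)|) ^+ 2 + Im (\tr (u *m v)) ^+ 2 =
          Re T ^+ 2 + Im T ^+ 2.
  by rewrite trace_outer !Re_sum !Im_sum.
rewrite add_Re2_Im2 lerXn2r ?nnegrE ?sumr_ge0 //.
apply: le_trans (ler_norm_sum _ _ _) _; apply: ler_sum => i _.
by rewrite !normc_def /= real_normK ?num_real.
Qed.

(** The Hermitian part of Y = uv has rank at most two, so when it is diagonal
    it has at most two nonzero entries.  Concretely, y_ii y_jj = y_ij y_ji is a
    nonpositive real for i <> j; for three diagonal entries with nonzero real parts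
    this makes them real with pairwise opposite signs. *)
Lemma outer_two_real_diag n (u : 'cV[C]_n) (v : 'rV[C]_n) (Y := u *m v)
    (i j l : 'I_n) :
  (forall i j, i != j -> Y i j + Num.conj (Y j i) = 0) ->
  i != j -> j != l -> i != l ->
  Re (Y i i) != 0 -> Re (Y j j) != 0 -> Re (Y l l) = 0.
Proof.
move=> hY ij jl il xi xj; apply/eqP/negPn/negP => xl.
(* The second-order minors of uv vanish. *)
have minor a b : a != b -> Y a a * Y b b = - (`|Y b a| ^+ 2).
  move=> ab; have := hY a b ab; rewrite addrC => /eqP; rewrite addr_eq0 => /eqP E.
  rewrite normCK E mulrN opprK !mxE !big_ord1; ring.
have {minor}minor a b : a != b ->
    Im (Y a a * Y b b) = 0 /\ Re (Y a a * Y b b) <= 0.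
  move=> ab; rewrite (minor a b ab) -add_Re2_Im2 /= oppr0; split=> //.
  by rewrite oppr_le0 addr_ge0 ?sqr_ge0.
move: (minor i j ij) (minor j l jl) (minor i l il) xi xj xl.
case: (Y i i) (Y j j) (Y l l) => [a1 b1] [a2 b2] [a3 b3] /=.
move=> [i12 r12] [i23 r23] [i13 r13] h1 h2 h3.
have b10 : b1 = 0.
  have : (2 * a2 * a3) * b1 = 0.
    rewrite (_ : _ * b1 = (a1 * b2 + b1 * a2) * a3 + (a1 * b3 + b1 * a3) * a2
                          - (a2 * b3 + b2 * a3) * a1); last by ring.
    by rewrite i12 i23 i13 !mul0r addr0 subr0.
  by move/eqP; rewrite !mulf_eq0 pnatr_eq0 (negbTE h2) (negbTE h3) /= => /eqP.
have b20 : b2 = 0.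
  by move/eqP: i12; rewrite b10 mul0r addr0 mulf_eq0 (negbTE h1) /= => /eqP.
have b30 : b3 = 0.
  by move/eqP: i13; rewrite b10 mul0r addr0 mulf_eq0 (negbTE h1) /= => /eqP.
move: r12 r23 r13; rewrite b10 b20 b30 !mul0r !subr0.
have p2 : 0 < a2 ^+ 2 by rewrite exprn_even_gt0.
move=> r12 r23 r13; have : 0 <= (a1 * a2) * (a2 * a3) by apply: mulr_le0.
have {}r13 : a1 * a3 < 0.
  by rewrite lt_neqAle r13 andbT mulf_neq0.
rewrite (_ : _ * _ = (a1 * a3) * a2 ^+ 2); last by ring.
by rewrite pmulr_lge0 // leNgt r13.
Qed.

Lemma outer_real_diag_support n (u : 'cV[C]_n) (v : 'rV[C]_n) (Y := u *m v)
    (i0 i1 : 'I_n) : i0 != i1 ->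
  (forall i j, i != j -> Y i j + Num.conj (Y j i) = 0) ->
  exists2 ij : 'I_n * 'I_n, ij.1 != ij.2 &
    forall l, l != ij.1 -> l != ij.2 -> Re (Y l l) = 0.
Proof.
move=> i01 hY; have [i xi|H] := pickP (fun i => Re (Y i i) != 0); last first.
  by exists (i0, i1) => // l _ _; apply/eqP/negPn; rewrite H.
have [j /andP[ji xj]|H] := pickP (fun j => (j != i) && (Re (Y j j) != 0)).
  exists (i, j); rewrite 1?eq_sym //= => l li lj.
  by apply: (@outer_two_real_diag _ u v i j l) => //; rewrite eq_sym.
have [j ij] : exists j, i != j.
  by have [->|?] := eqVneq i i0; [exists i1 | exists i0].
exists (i, j) => //= l li _; apply/eqP/negPn; apply/negP => xl.
by have := H l; rewrite li xl.
Qed.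

(** The two real parts are half the eigenvalues of H = Y + Y^*, whose sum and
    sum of squares are tr H and tr H^2; the latter is expressed through tr Y and
    the Frobenius norm since tr Y^2 = (tr Y)^2 in rank one. *)
Lemma outer_real_diag_gap n (u : 'cV[C]_n) (v : 'rV[C]_n) (Y := u *m v)
    (i j : 'I_n) : i != j ->
  (forall i j, i != j -> Y i j + Num.conj (Y j i) = 0) ->
  (forall l, l != i -> l != j -> Re (Y l l) = 0) ->
  Re (\tr Y) = Re (Y i i) + Re (Y j j) /\
  (Re (Y i i) - Re (Y j j)) ^+ 2 = Re (frob Y) - Im (\tr Y) ^+ 2.
Proof.
move=> ij hY h0.
have sum2 (f : R -> R) : f 0 = 0 ->
    \sum_l f (Re (Y l l)) = f (Re (Y i i)) + f (Re (Y j j)).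
  move=> f0; rewrite (bigD1 i) //= (bigD1 j) 1?eq_sym //= big1 ?addr0 //.
  by move=> l /andP[li lj]; rewrite h0.
have ReT : Re (\tr Y) = Re (Y i i) + Re (Y j j).
  by rewrite Re_sum (sum2 id).
split=> //.
pose H := Y + Y^t*.
have HE a b : H a b = (2 * Re (Y a a))%:C *+ (a == b).
  rewrite /H mxE [_^t* _ _]mxE [_^T _ _]mxE.
  have [<-|ab] := eqVneq a b; last exact: hY.
  by rewrite mulr1n rmorphM /= rmorph_nat -addcJ.
have trYY : \tr (Y *m Y) = (\tr Y) ^+ 2 by apply: mxtrace_outer_sqr.
have trHH : \tr (H *m H) = (\sum_l (2 * Re (Y l l)) ^+ 2)%:C.
  rewrite rmorph_sum; apply: eq_bigr => a _; rewrite mxE (bigD1 a) //= big1.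
    by rewrite addr0 !HE eqxx mulr1n rmorphXn expr2.
  by move=> b ba; rewrite HE eq_sym (negbTE ba) mul0r.
(* The same trace from the definition of H. *)
have trHH' : \tr (H *m H) = (\tr Y) ^+ 2 + Num.conj (\tr Y) ^+ 2 + 2 * frob Y.
  rewrite /H mulmxDr !mulmxDl !mxtraceD (mxtrace_mulC (Y^t*) Y) -/(frob Y).
  rewrite trYY -ctrmxM mxtrace_ctrmx.
  by rewrite trYY rmorphXn /=; ring.
have : 4 * (Re (Y i i) ^+ 2 + Re (Y j j) ^+ 2) =
       2 * (Re (\tr Y) ^+ 2 - Im (\tr Y) ^+ 2) + 2 * Re (frob Y).
  have := sum2 (fun x => (2 * x) ^+ 2); rewrite mulr0 expr0n => /(_ erefl).
  move=> E; move: trHH'; rewrite trHH E frob_real => /(congr1 Re).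
  case: (\tr Y) => q1 q2 /=; simpc => /=; lra.
rewrite ReT; lra.
Qed.

End RankOneSupport.

(** * The range of a matrix of rank one *)

Section RankOneRange.
Variables (R : rcfType) (n : nat) (d : 'I_n -> R) (i0 i1 : 'I_n).
Local Notation C := R[i].
Local Notation Re := (@complex.Re R).
Local Notation Im := (@complex.Im R).
Hypothesis d_le : forall i, d i1 <= d i <= d i0.
Hypothesis d_lt : d i1 < d i0.
Implicit Types (X Y V : 'M[C]_n).

Lemma rank_le1_outer m (X : 'M[C]_m) : (\rank X <= 1)%N ->
  exists u : 'cV_m, exists v : 'rV_m, X = u *m v.
Proof.
have := mulmx_base X; move: (col_base X) (row_base X).
case: (\rank X) => [|[|r]] // A B <- _; last by exists A, B.
by exists 0, 0; rewrite mul0mx [A]thinmx0 mul0mx.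
Qed.

Lemma rank_outer_le1 m (u : 'cV[C]_m) (v : 'rV[C]_m) : (\rank (u *m v) <= 1)%N.
Proof. by apply: leq_trans (mulmx_max_rank _ _) _. Qed.

Lemma frobZ a X : frob (a *: X) = `|a| ^+ 2 * frob X.
Proof.
rewrite !frobE mulr_sumr; apply: eq_bigr => i _; rewrite mulr_sumr.
by apply: eq_bigr => j _; rewrite mxE normrM exprMn.
Qed.

Lemma frob_conj V X : V \is unitarymx -> frob (V *m X *m V^t*) = frob X.
Proof.
move=> hV; rewrite /frob !ctrmxM trmxCK !mulmxA.
rewrite -(mulmxA _ (V^t*) V) unitarymx_mulVK // mulmx1.
by rewrite mxtrace_mulC !mulmxA unitarymx_mulVK // mul1mx.
Qed.

Lemma mxtrace_conj V X : V \is unitarymx -> \tr (V *m X *m V^t*) = \tr X.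
Proof.
by move=> hV; rewrite mxtrace_mulC mulmxA unitarymx_mulVK // mul1mx.
Qed.

(** For X of rank at most one, the square of the difference of the two
    extreme eigenvalues of the Hermitian part of X. *)
Definition gap2 X : R := Re (frob X) - Im (\tr X) ^+ 2.

(** With l1 >= l2 the two eigenvalues of the Hermitian part of X, this is
    d_max l1 + d_min l2. *)
Definition top_re X : R :=
  ((d i0 + d i1) * Re (\tr X) + (d i0 - d i1) * Num.sqrt (gap2 X)) / 2.

Lemma gap2_conj V X : V \is unitarymx -> gap2 (V *m X *m V^t*) = gap2 X.
Proof. by move=> hV; rewrite /gap2 frob_conj // mxtrace_conj. Qed.

Lemma gap2_ge0 X : (\rank X <= 1)%N -> 0 <= gap2 X.
Proof.
move=> /rank_le1_outer[u [v ->]].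
rewrite subr_ge0; apply: le_trans (sum_Re_outer u v).
by rewrite lerDr sqr_ge0.
Qed.

(** Centering the weights at (d_max + d_min) / 2 leaves weights of modulus at
    most (d_max - d_min) / 2, and [sum_Re_outer] bounds the sum of the |Re p_i|. *)
Lemma top_re_ub X z : (\rank X <= 1)%N -> wrange d X z -> Re z <= top_re X.
Proof.
move=> rX [V /= hV <-]; rewrite /top_re -(gap2_conj X hV) -(mxtrace_conj X hV).
have /rank_le1_outer[u [v ->]] : (\rank (V *m X *m V^t*) <= 1)%N.
  by apply: leq_trans (mxrankM_maxl _ _) _; apply: leq_trans (mxrankM_maxr _ _) _.
have := sum_Re_outer u v; rewrite -lerBrDr -/(gap2 _) => le_gap.
have {}le_gap : \sum_i `|Re (u i 0 * v 0 i)| <= Num.sqrt (gap2 (u *m v)).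
  rewrite -[leLHS]ger0_norm ?sumr_ge0 // -sqrtr_sqr ler_wsqrtr //.
rewrite /wtrace Re_sum trace_outer Re_sum.
rewrite ler_pdivlMr // mulrC mulr_sumr.
apply: (@le_trans _ _ (\sum_i ((d i0 + d i1) * Re (u i 0 * v 0 i)
                   + (d i0 - d i1) * `|Re (u i 0 * v 0 i)|))).
  apply: ler_sum => i _; rewrite Re_realM !mxE big_ord1.
  move: (Re _) (d_le i) => x /andP[h1 h0].
  have [x0|/ltW x0] := ger0P x.
    have := mulr_ge0 (_ : 0 <= d i0 - d i) x0; rewrite subr_ge0 => /(_ h0); lra.
  have := mulr_ge0 (_ : 0 <= d i - d i1) (_ : 0 <= - x).
  rewrite subr_ge0 oppr_ge0 => /(_ h1 x0); lra.
rewrite big_split /= -!mulr_sumr lerD2l ler_wpM2l // subr_ge0 ltW //.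
Qed.

(** Diagonalize the Hermitian part and place its two eigenvalues on the
    largest and the smallest weight. *)
Lemma top_re_attained X : (\rank X <= 1)%N ->
  exists2 z, wrange d X z & Re z = top_re X.
Proof.
move=> /rank_le1_outer[u0 [v0 ->]]; set X0 := u0 *m v0.
have [P hP [s hs]] : exists2 P : 'M[C]_n, P \is unitarymx &
    exists s : 'I_n -> R,
      P *m (X0 + X0^t*) *m P^t* = \matrix_(i, j) ((s i)%:C *+ (i == j)).
  by apply: hermitian_diagonalization; rewrite ctrmxD trmxCK addrC.
pose u := P *m u0; pose v := v0 *m P^t*; pose Y := u *m v.
have YE : Y = P *m X0 *m P^t* by rewrite /Y /u /v /X0 !mulmxA.
have hY i j : i != j -> Y i j + Num.conj (Y j i) = 0.
  move=> ij; have -> : Y i j + Num.conj (Y j i) = (Y + Y^t*) i j.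
    by rewrite [RHS]mxE [_^t* _ _]mxE [_^T _ _]mxE.
  have -> : Y + Y^t* = P *m (X0 + X0^t*) *m P^t*.
    by rewrite YE !ctrmxM trmxCK mulmxDr mulmxDl !mulmxA.
  by rewrite hs mxE (negbTE ij).
have i01 : i0 != i1 by apply: contraTneq d_lt => ->; rewrite ltxx.
have [[i j] /= ij h0] := outer_real_diag_support i01 hY.
have [] := outer_real_diag_gap ij hY h0; rewrite -/Y.
have -> : Re (frob Y) - Im (\tr Y) ^+ 2 = gap2 X0 by rewrite YE -(gap2_conj X0 hP).
rewrite {1}YE mxtrace_conj // => trE gapE.
wlog le_ij : i j ij h0 trE gapE / Re (Y j j) <= Re (Y i i).
  move=> W; have [|/ltW] := leP (Re (Y j j)) (Re (Y i i)); first exact: W.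
  apply: (W j i) => //; first by rewrite eq_sym.
  - by move=> l lj li; apply: h0.
  - by rewrite addrC.
  - by rewrite -gapE -sqrrN opprB.
have [t [ti tj]] := perm_two_points i01 ij.
exists (\sum_l (d l)%:C * (P *m X0 *m P^t*) (t l) (t l)).
  exact: wrange_permute.
rewrite -YE Re_sum (bigD1 i0) //= (bigD1 i1) 1?eq_sym //= big1 ?addr0.
  rewrite !Re_realM ti tj /top_re trE -gapE sqrtr_sqr ger0_norm ?subr_ge0 //.
  by field.
move=> l /andP[l0 l1]; rewrite Re_realM h0 ?mulr0 // -1?ti -1?tj.
  by rewrite (inj_eq perm_inj).
by rewrite (inj_eq perm_inj).
Qed.

Lemma wrange_eq_top_re X Y : (\rank X <= 1)%N -> (\rank Y <= 1)%N ->
  wrange d X = wrange d Y -> top_re X = top_re Y.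
Proof.
move=> rX rY E; apply/le_anti/andP; split.
  have [z hz <-] := top_re_attained rX; apply: (top_re_ub rY); rewrite -E; exact: hz.
have [z hz <-] := top_re_attained rY; apply: (top_re_ub rX); rewrite E; exact: hz.
Qed.

Lemma gap2N X : gap2 (- X) = gap2 X.
Proof.
rewrite /gap2 -scaleN1r frobZ normrN1 expr1n mul1r mxtraceZ mulN1r.
by case: (\tr X) => a b /=; rewrite sqrrN.
Qed.

Lemma rankN_le1 X : (\rank (- X) <= 1)%N = (\rank X <= 1)%N.
Proof. by rewrite mxrank_opp. Qed.

Lemma top_reN X : top_re X - top_re (- X) = (d i0 + d i1) * Re (\tr X).
Proof.
rewrite /top_re gap2N raddfN /=; case: (\tr X) => a b /=; by field.
Qed.

(** The sum of the maxima for X and -X is (d_max - d_min) times the square root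
    of the gap. *)
Lemma wrange_eq_gap2 X Y : (\rank X <= 1)%N -> (\rank Y <= 1)%N ->
  wrange d X = wrange d Y -> gap2 X = gap2 Y.
Proof.
move=> rX rY E; have E1 := wrange_eq_top_re rX rY E.
have E2 : top_re (- X) = top_re (- Y).
  apply: wrange_eq_top_re; [by rewrite rankN_le1 | by rewrite rankN_le1 |].
  by rewrite -[- X]scaleN1r -[- Y]scaleN1r; exact: wrange_eqZ E.
have := top_reN X; have := top_reN Y; rewrite -E1 -E2 => -> E3.
move: E1; rewrite /top_re -E3 => E1.
have d0 : d i0 - d i1 != 0 by rewrite subr_eq0 gt_eqF.
have : Num.sqrt (gap2 X) = Num.sqrt (gap2 Y).
  by apply: (mulfI d0); lra.
move=> /(congr1 (fun x => x ^+ 2)); rewrite !sqr_sqrtr ?gap2_ge0 //.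
Qed.

Lemma rankZ_le1 a X : (\rank X <= 1)%N -> (\rank (a *: X) <= 1)%N.
Proof. by apply: leq_trans; rewrite -mul_scalar_mx mxrankM_maxr. Qed.

(** The gaps of X, iX and (1 + i)X give the real and imaginary parts of
    (tr X)^2, then |tr X|^2 and the Frobenius norm. *)
Lemma wrange_eq_invariants X Y : (\rank X <= 1)%N -> (\rank Y <= 1)%N ->
  wrange d X = wrange d Y -> (\tr X) ^+ 2 = (\tr Y) ^+ 2 /\ frob X = frob Y.
Proof.
move=> rX rY E.
have gapZ (a b : R) : gap2 ((a +i* b) *: X) = gap2 ((a +i* b) *: Y).
  by apply: wrange_eq_gap2 (wrange_eqZ _ E); apply: rankZ_le1.
have := gapZ 1 0; have := gapZ 0 1; have := gapZ 1 1.
rewrite /gap2 !frobZ !mxtraceZ (frob_real X) (frob_real Y) -!add_Re2_Im2.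
rewrite -!rmorphM /=.
move: (Re (frob X)) (Re (frob Y)) (\tr X) (\tr Y).
move=> m1 m2 [a1 b1] [a2 b2] /= h1 h2 h3.
have eab : a1 * b1 = a2 * b2 by lra.
have eaa : a1 ^+ 2 - b1 ^+ 2 = a2 ^+ 2 - b2 ^+ 2 by lra.
(* |q|^2 is determined by its square, |q|^4 = (Re q^2)^2 + (Im q^2)^2. *)
have esq : (a1 ^+ 2 + b1 ^+ 2) ^+ 2 = (a2 ^+ 2 + b2 ^+ 2) ^+ 2.
  rewrite (_ : (a1 ^+ 2 + b1 ^+ 2) ^+ 2 = (a1 ^+ 2 - b1 ^+ 2) ^+ 2 + 4 * (a1 * b1) ^+ 2); last by ring.
  by rewrite eaa eab; ring.
have enorm : a1 ^+ 2 + b1 ^+ 2 = a2 ^+ 2 + b2 ^+ 2.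
  by apply/eqP; rewrite -(@eqrXn2 _ 2) ?addr_ge0 ?sqr_ge0 // esq.
split; last by congr (_%:C); lra.
by rewrite !expr2; simpc; congr (_ +i* _); lra.
Qed.

(** Symmetry equates the maxima for aX and -aX; their difference is
    (d_max + d_min) Re (a tr X). *)
Lemma symmetric_rank1_trace0 X : d i0 + d i1 != 0 -> (\rank X <= 1)%N ->
  wrange d X = wrange d (- X) -> \tr X = 0.
Proof.
move=> d0 rX E.
have hRe a : Re (a * \tr X) = 0.
  have : top_re (a *: X) = top_re (- (a *: X)).
    apply: wrange_eq_top_re; [exact: rankZ_le1 | by rewrite rankN_le1 rankZ_le1 |].
    by rewrite -scalerN; exact: wrange_eqZ E.
  move/eqP; rewrite -subr_eq0 top_reN mulf_eq0 (negbTE d0) /= mxtraceZ.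
  by move/eqP.
have := hRe 1; have := hRe 'i; case: (\tr X) => a b /=.
rewrite !mul0r !mul1r subr0 sub0r => /eqP; rewrite oppr_eq0 => /eqP -> ->.
by [].
Qed.

End RankOneRange.

(** * Maps preserving which products are scalar matrices *)

Section ZeroProducts.
Variables (F : fieldType) (n : nat).
Hypothesis n_gt1 : (1 < n)%N.
Implicit Types A B : 'M[F]_n.

Lemma unitmx_neq0 A : A \in unitmx -> A <> 0.
Proof.
move=> + A0; rewrite A0 => /mulmxV; rewrite mul0mx.
move=> /matrixP/(_ (Ordinal n_gt1) (Ordinal n_gt1)).
by rewrite !mxE eqxx => /eqP; rewrite eq_sym oner_eq0.
Qed.

Lemma outer_scalar_eq0 (u : 'cV[F]_n) (v : 'rV[F]_n) :
  is_scalar_mx (u *m v) -> u *m v = 0.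
Proof.
case/is_scalar_mxP => a E; rewrite E.
have [->|a0] := eqVneq a 0; first by rewrite raddf0.
have : (\rank (u *m v) <= 1)%N by apply: leq_trans (mulmx_max_rank _ _) _.
by rewrite E -scalemx1 mxrank_scale_nz // mxrank1 leqNgt n_gt1.
Qed.

Lemma all_products_scalar A : (forall B, is_scalar_mx (A *m B)) <-> A = 0.
Proof.
split=> [hA|-> B]; last by rewrite mul0mx mx0_is_scalar.
have /is_scalar_mxP[a Ea] := hA 1%:M; rewrite mulmx1 in Ea.
pose i := Ordinal (ltnW n_gt1); pose j := Ordinal n_gt1.
have /is_scalar_mxP[b /matrixP/(_ i j)] := hA (delta_mx i j).
rewrite Ea mul_scalar_mx !mxE !eqxx mulr1 => ->.
by rewrite raddf0.
Qed.

(** If A is singular and nonzero, take v <> 0 with vA = 0 and B = wv: then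
    BA = 0 is scalar, while AB = (Aw)v has rank one for a suitable w. *)
Lemma scalar_products_sym A :
  (forall B, is_scalar_mx (A *m B) = is_scalar_mx (B *m A)) <->
  A = 0 \/ A \in unitmx.
Proof.
split=> [hA|[->|hA] B]; last 2 first.
- by rewrite mul0mx mulmx0.
- apply/is_scalar_mxP/is_scalar_mxP => -[a E]; exists a.
    rewrite -(mulKmx hA B) E mul_mx_scalar -scalemxAl mulVmx //.
    by rewrite scalemx1.
  rewrite -(mulmxK hA B) E mul_scalar_mx -scalemxAr mulmxV //.
  by rewrite scalemx1.
have [|nA] := boolP (A \in unitmx); [by right | left].
have /rowV0Pn[v /sub_kermxP vA v0] : kermx A != 0.
  by rewrite kermx_eq0 row_free_unit.
apply/all_products_scalar => B; rewrite (_ : A = 0) ?mul0mx ?mx0_is_scalar //.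
suff hw (w : 'cV_n) : A *m w = 0.
  apply/matrixP => i j; have /matrixP/(_ i 0) := hw (delta_mx j 0).
  by rewrite -colE !mxE.
have := hA (w *m v); rewrite -(mulmxA w) vA mulmx0 mx0_is_scalar mulmxA.
move=> /outer_scalar_eq0/eqP; rewrite mul_mx_rowfree_eq0; first by move/eqP.
by rewrite /row_free rank_rV v0.
Qed.

Lemma submx_annihilator A B :
  (A <= B)%MS <-> (forall X : 'M_n, B *m X = 0 -> A *m X = 0).
Proof.
split=> [/submxP[D ->] X BX|h]; first by rewrite -mulmxA BX mulmx0.
by rewrite submxE; apply/eqP/h; rewrite mulmx_coker.
Qed.

(** Rank one is expressed through the order of row spaces, which is the form in
    which it can be transported by a map preserving zero products. *)
Lemma rank1_minimal A : \rank A = 1%N <->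
  A <> 0 /\ forall A', A' <> 0 -> (A' <= A)%MS -> (A <= A')%MS.
Proof.
split=> [rA|[A0 hA]].
  split=> [A0|A' /eqP A'0 le]; first by rewrite A0 mxrank0 in rA.
  rewrite -(mxrank_leqif_sup le) rA eqn_leq -{1}rA mxrankS //= lt0n.
  by rewrite mxrank_eq0.
have r0 : nz_row A != 0 by rewrite nz_row_eq0; apply/eqP.
pose w : 'cV[F]_n := const_mx 1; pose A' := w *m nz_row A.
have A'0 : A' <> 0.
  move/eqP; rewrite mul_mx_rowfree_eq0 /row_free ?rank_rV ?r0 //.
  move=> /eqP/matrixP/(_ (Ordinal (ltnW n_gt1)) 0); rewrite !mxE => /eqP; by rewrite oner_eq0.
have rA : (\rank A <= 1)%N.
  apply: leq_trans (mxrankS (hA A' A'0 _)) _.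
    by apply: submx_trans (submxMl _ _) (nz_row_sub _).
  by apply: leq_trans (mulmx_max_rank _ _) _.
by apply/eqP; rewrite eqn_leq rA lt0n mxrank_eq0; apply/eqP.
Qed.

Variable Phi : 'M[F]_n -> 'M[F]_n.
Hypothesis Phi_surj : forall B, exists A, Phi A = B.
Hypothesis Phi_scalar : forall A B,
  is_scalar_mx (Phi A *m Phi B) = is_scalar_mx (A *m B).

Lemma preserver_eq0 A : Phi A = 0 <-> A = 0.
Proof.
rewrite -!all_products_scalar; split=> h B; first by rewrite -Phi_scalar.
by have [B' <-] := Phi_surj B; rewrite Phi_scalar.
Qed.

Lemma preserver_unit A : (Phi A \in unitmx) <-> (A \in unitmx).
Proof.
have P : (Phi A = 0 \/ Phi A \in unitmx) <-> (A = 0 \/ A \in unitmx).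
  rewrite -!scalar_products_sym; split=> h B.
    by rewrite -(Phi_scalar A B) h Phi_scalar.
  by have [B' <-] := Phi_surj B; rewrite !Phi_scalar.
split=> h.
  case: P.1; [by right | move=> A0 | by []].
  by case: (unitmx_neq0 h); apply/preserver_eq0.
case: P.2; [by right | move=> /preserver_eq0 A0 | by []].
by case: (unitmx_neq0 h).
Qed.

(** When AB is a scalar matrix, it is zero unless both factors are invertible. *)
Lemma preserver_mul_eq0 A B : Phi A *m Phi B = 0 <-> A *m B = 0.
Proof.
(* The right-hand side is visibly invariant under Phi. *)
have key (X Y : 'M[F]_n) : X *m Y = 0 <->
    is_scalar_mx (X *m Y) /\ ~ (X \in unitmx /\ Y \in unitmx).
  split=> [XY|[/is_scalar_mxP[a E] nu]].
    rewrite XY mx0_is_scalar; split=> // -[uX uY].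
    by apply: (@unitmx_neq0 (X *m Y)) XY; rewrite unitmx_mul uX.
  have [a0|a0] := eqVneq a 0; first by rewrite E a0 raddf0.
  case: nu; apply/andP; rewrite -unitmx_mul E unitmxE det_scalar.
  by rewrite unitrX // unitfE.
by rewrite !key Phi_scalar !preserver_unit.
Qed.

Lemma preserver_submx A B : (Phi A <= Phi B)%MS <-> (A <= B)%MS.
Proof.
rewrite !submx_annihilator; split=> h X.
  by rewrite -(preserver_mul_eq0 B) -(preserver_mul_eq0 A); apply: h.
by have [X' <-] := Phi_surj X; rewrite !preserver_mul_eq0; apply: h.
Qed.

Lemma preserver_rank1 A : \rank A = 1%N -> \rank (Phi A) = 1%N.
Proof.
rewrite !rank1_minimal => -[A0 hA]; split=> [/preserver_eq0//|B B0 BA].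
have [A' EA'] := Phi_surj B; move: B0 BA; rewrite -EA' preserver_eq0.
by rewrite !preserver_submx; apply: hA.
Qed.

End ZeroProducts.

(** * Tests against matrices of rank one *)

Section MomentTests.
Variables (F : numFieldType) (n : nat).
Implicit Types M N : 'M[F]_n.

Lemma poly_nat_roots_eq0 (p : {poly F}) : (forall k, p.[k.+1%:R] = 0) -> p = 0.
Proof.
move=> hp; apply/eqP/negPn/negP => p0.
pose rs : seq F := [seq k.+1%:R | k <- iota 0 (size p)].
have rs_root : all (root p) rs.
  by apply/allP => x /mapP[k _ ->]; apply/rootP/hp.
have rs_uniq : uniq rs.
  by rewrite map_inj_uniq ?iota_uniq // => a b /eqP; rewrite eqr_nat => /eqP[].
by have := max_poly_roots p0 rs_root rs_uniq; rewrite size_map size_iota ltnn.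
Qed.

(** The entry at (j, i) is t^(ni + j): the exponents are pairwise distinct, so
    that the trace against M is a polynomial in t with coefficients m_ij. *)
Definition moment_mx (t : F) : 'M_n := (\col_j t ^+ j) *m (\row_i t ^+ (n * i)).

Definition moment_poly M : {poly F} :=
  \sum_(i < n) \sum_(j < n) M i j *: 'X^(n * i + j).

Lemma moment_polyE M (i j : 'I_n) : (moment_poly M)`_(n * i + j) = M i j.
Proof.
have n0 : (0 < n)%N := leq_ltn_trans (leq0n _) (ltn_ord i).
have inj (a b : 'I_n) : (n * i + j == n * a + b)%N = (a == i) && (b == j).
  apply/eqP/andP => [E|[/eqP -> /eqP ->] //].
  have := congr1 (fun x => x %/ n)%N E; have := congr1 (fun x => x %% n)%N E.
  rewrite /= !(mulnC n) !divnMDl // !modnMDl !modn_small // !divn_small // !addn0.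
  by move=> /val_inj -> /val_inj ->.
rewrite coef_sum (bigD1 i) //= coef_sum (bigD1 j) //= big1 => [|b bj]; last first.
  by rewrite coefZ coefXn inj eqxx (negbTE bj) mulr0.
rewrite coefZ coefXn inj !eqxx mulr1 addr0 big1 ?addr0 // => a ai.
by rewrite coef_sum big1 // => b _; rewrite coefZ coefXn inj (negbTE ai) mulr0.
Qed.

Lemma trace_moment_mx M t : \tr (M *m moment_mx t) = (moment_poly M).[t].
Proof.
rewrite horner_sum; apply: eq_bigr => i _; rewrite mxE horner_sum.
apply: eq_bigr => j _; rewrite !mxE big_ord1 !mxE hornerZ hornerXn.
by rewrite exprD [_ ^+ j * _]mulrC.
Qed.

Lemma moment_tests_eq0 M N :
  (forall k, \tr (M *m moment_mx k.+1%:R) * \tr (N *m moment_mx k.+1%:R) = 0) ->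
  M = 0 \/ N = 0.
Proof.
have E0 X : moment_poly X = 0 -> X = 0.
  by move=> X0; apply/matrixP => i j; rewrite -moment_polyE X0 coef0 mxE.
move=> h; have : moment_poly M * moment_poly N = 0.
  apply: poly_nat_roots_eq0 => k.
  by rewrite hornerM -!trace_moment_mx h.
by move/eqP; rewrite mulf_eq0 => /orP[/eqP/E0|/eqP/E0]; [left | right].
Qed.

End MomentTests.

Section Structure.
Variables (R : rcfType) (n : nat).
Local Notation C := R[i].
Implicit Types (A B U : 'M[C]_n) (Phi : 'M[C]_n -> 'M[C]_n).

Lemma mxtraceB m (A B : 'M[C]_m) : \tr (A - B) = \tr A - \tr B.
Proof. exact: raddfB. Qed.

(** What the c-numerical ranges of products reveal about [Phi], apart from
    signs.  All that follows uses only these properties, which are invariant under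
    unitary similarity. *)
Definition rank1_test_preserver Phi : Prop :=
  [/\ forall A B, A *m B = 0 -> Phi A *m Phi B = 0,
      forall B, \rank B = 1%N -> \rank (Phi B) = 1%N,
      forall A B, \rank B = 1%N ->
        \tr (Phi A *m Phi B) ^+ 2 = \tr (A *m B) ^+ 2 &
      forall A B, \rank B = 1%N ->
        frob (Phi A *m Phi B) = frob (A *m B)].

Lemma rank1_test_preserver_conj Phi U : U \is unitarymx ->
  rank1_test_preserver Phi ->
  rank1_test_preserver (fun A => U^t* *m Phi A *m U).
Proof.
move=> hU [P0 P1 P2 P3].
have hU' : U^t* \is unitarymx by rewrite trmxC_unitary.
have E A B : (U^t* *m Phi A *m U) *m (U^t* *m Phi B *m U) =
             U^t* *m (Phi A *m Phi B) *m (U^t*)^t*.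
  rewrite trmxCK !mulmxA -(mulmxA _ U) (unitarymxP hU) mulmx1 //.
split=> [A B /P0 AB|B /P1 rB|A B rB|A B rB].
- by rewrite E AB mulmx0 mul0mx.
- rewrite -mulmxA (eqmxMfull _ _) ?row_full_unit ?unitarymx_unit //.
  have fU : row_free U by rewrite row_free_unit; exact: unitarymx_unit hU.
  by rewrite (mxrankMfree _ fU).
- by rewrite E mxtrace_conj // P2.
- by rewrite E frob_conj // P3.
Qed.

(** Write B = uv.  The hypotheses give |vu| = 1 = |u| |v|, which is the
    equality case of the Cauchy-Schwarz inequality, so v is a multiple of u^*. *)
Lemma rank1_unit_square B : \rank B = 1%N ->
  \tr (B *m B) ^+ 2 = 1 -> frob (B *m B) = 1 ->
  exists t : C, exists f : 'cV[C]_n,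
    [/\ `|t| = 1, f^t* *m f = 1%:M & B = t *: (f *m f^t*)].
Proof.
move=> rB; have [u [v ->]] : exists u : 'cV_n, exists v : 'rV_n, B = u *m v.
  by apply: rank_le1_outer; rewrite rB.
pose t := (v *m u) 0 0.
have vu : v *m u = t%:M by rewrite [LHS]mx11_scalar.
have -> : (u *m v) *m (u *m v) = t *: (u *m v).
  by rewrite mulmxA -(mulmxA u v u) vu mul_mx_scalar -scalemxAl.
have -> : \tr (t *: (u *m v)) = t ^+ 2.
  by rewrite mxtraceZ mxtrace_mulC vu mxtrace_scalar mulr1n.
rewrite frobZ frob_outer => t4 tf.
have t1 : `|t| = 1.
  apply/eqP; rewrite -(@eqrXn2 _ 4) // expr1n -normrX -(exprM t 2 2) in t4 *.
  by rewrite t4 normr1.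
move: tf; rewrite t1 expr1n mul1r => uv1.
have N0 : 0 < frob u.
  rewrite lt_neqAle frob_ge0 andbT eq_sym; apply/eqP => u0.
  by move/eqP: uv1; rewrite u0 mul0r eq_sym oner_eq0.
have uu : u^t* *m u = (frob u)%:M.
  by rewrite [LHS]mx11_scalar /frob mxtrace_mulC /mxtrace big_ord1.
(* The coefficient is forced by vu = t. *)
have vE : v = (t / frob u) *: u^t*.
  apply/eqP; rewrite -subr_eq0; set w := _ - _.
  have tn : t != 0 by rewrite -normr_eq0 t1 oner_eq0.
  have Nn : frob u != 0 by rewrite lt0r_neq0.
  have tc : Num.conj t = t^-1.
    by apply: (mulfI tn); rewrite -normCK t1 expr1n mulfV.
  have cc : Num.conj (t / frob u) = t^-1 / frob u.
    have -> : Num.conj (t / frob u) = Num.conj t / Num.conj (frob u).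
      by rewrite rmorphM fmorphV.
    rewrite tc; congr (_ / _); apply/CrealP.
    by rewrite ger0_real ?frob_ge0.
  have vN : frob v = (frob u)^-1 by apply: (mulfI Nn); rewrite uv1 mulfV.
  have : frob w = 0.
    rewrite /frob /w ctrmxB ctrmxZ trmxCK mulmxBr !mulmxBl.
    rewrite -!scalemxAl -!scalemxAr uu vu cc.
    have -> : u^t* *m v^t* = t^-1%:M.
      by rewrite -ctrmxM vu tr_scalar_mx map_scalar_mx -tc.
    rewrite !mxtraceB !mxtraceZ -/(frob v) !mxtrace_scalar !mulr1n vN.
    by field; rewrite Nn tn.
  by move/frob_eq0 ->.
have s2 : sqrtC (frob u) * sqrtC (frob u) = frob u by rewrite -expr2 sqrtCK.
have s0 : 0 < sqrtC (frob u) by rewrite sqrtC_gt0.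
have sr : Num.conj (sqrtC (frob u))^-1 = (sqrtC (frob u))^-1.
  by apply/CrealP; rewrite rpredV ger0_real // ltW.
exists t, ((sqrtC (frob u))^-1 *: u); split=> //.
  rewrite ctrmxZ sr -scalemxAl -scalemxAr uu scalerA -invfM s2.
  by rewrite scale_scalar_mx mulVf // lt0r_neq0.
rewrite ctrmxZ sr -scalemxAl -scalemxAr !scalerA {1}vE -scalemxAr.
by rewrite -[in RHS]mulrA -invfM s2.
Qed.

(** The images of the diagonal matrix units are multiples of the projections
    on lines, which are pairwise orthogonal since zero products are preserved. *)
Lemma preserved_frame Phi : rank1_test_preserver Phi ->
  exists2 U, U \is unitarymx &
    forall i, exists2 t : C, `|t| = 1 &
      U^t* *m Phi (delta_mx i i) *m U = t *: delta_mx i i.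
Proof.
move=> [P0 P1 P2 P3].
have rE (i j : 'I_n) : \rank (delta_mx i j : 'M[C]_n) = 1%N by rewrite mxrank_delta.
have EE (i : 'I_n) : delta_mx i i *m delta_mx i i = delta_mx i i :> 'M[C]_n.
  by rewrite mul_delta_mx.
have trE1 (i : 'I_n) : \tr (delta_mx i i : 'M[C]_n) = 1.
  by rewrite -(@frob_delta R n n i i) /frob trmx_delta map_delta_mx EE.
have /fin_all_exists2[/= t t1 /fin_all_exists2[/= f f1 fE]] :
  forall i : 'I_n, exists2 t : C, `|t| = 1 & exists2 f : 'cV[C]_n,
    f^t* *m f = 1%:M & Phi (delta_mx i i) = t *: (f *m f^t*).
  move=> i; have [||t [f [h1 h2 h3]]] := rank1_unit_square (P1 _ (rE i i)).
  - by rewrite P2 // EE trE1 expr1n.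
  - by rewrite P3 // EE frob_delta.
  by exists t => //; exists f.
pose U := \matrix_(i, j) f j i 0.
have colU j : U *m delta_mx j 0 = f j :> 'cV_n.
  by rewrite -colE; apply/matrixP => i k; rewrite !mxE ord1.
have t0 i : t i != 0 by rewrite -normr_eq0 t1 oner_eq0.
have UU : U^t* *m U = 1%:M.
  apply/matrixP => i j.
  have -> : (U^t* *m U) i j = ((f i)^t* *m f j) 0 0.
    by rewrite !mxE; apply: eq_bigr => k _; rewrite !mxE.
  rewrite [RHS]mxE; have [<-|ij] := eqVneq i j; first by rewrite f1 mxE.
  have : Phi (delta_mx i i) *m Phi (delta_mx j j) = 0.
    by apply: P0; rewrite mul_delta_mx_0.
  rewrite !fE -scalemxAl -scalemxAr => /eqP; rewrite !scaler_eq0 !(negbTE (t0 _)) /=.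
  move=> /eqP /(congr1 (fun X => (f i)^t* *m X *m f j)).
  rewrite !mulmxA f1 mul1mx -[X in X = _]mulmxA f1 mulmx1 mulmx0 mul0mx => ->.
  by rewrite mxE.
have hU : U \is unitarymx by apply/unitarymxP; apply: mulmx1C.
exists U => // i; exists (t i) => //.
rewrite fE -scalemxAr -scalemxAl -colU ctrmxM !mulmxA UU mul1mx.
by rewrite -!mulmxA UU mulmx1 trmx_delta map_delta_mx mul_delta_mx.
Qed.

End Structure.

(** * Alignment of phases *)

Section Alignment.
Variables (R : realType) (n : nat).
Local Notation C := R[i].
Implicit Types (A B U : 'M[C]_n) (Phi : 'M[C]_n -> 'M[C]_n).

Lemma expr4_eq1_norm (t : C) : t ^+ 4 = 1 -> `|t| = 1.
Proof.
by move=> t4; apply/eqP; rewrite -(@eqrXn2 _ 4) // expr1n -normrX t4 normr1.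
Qed.

(** Zero products with the diagonal matrix units force the image of e_ji to be
    k e_ji with |k| = 1; the trace of A against e_ji is the entry a_ij. *)
Lemma preserved_moduli Phi : rank1_test_preserver Phi ->
  (forall i, exists2 t : C, `|t| = 1 &
     Phi (delta_mx i i) = t *: delta_mx i i) ->
  forall A i j, `|Phi A i j| = `|A i j|.
Proof.
move=> [P0 P1 P2 P3] hE A i j.
have rE (a b : 'I_n) : \rank (delta_mx a b : 'M[C]_n) = 1%N by rewrite mxrank_delta.
have t_neq0 (t : C) : `|t| = 1 -> t != 0.
  by move=> t1; rewrite -normr_eq0 t1 oner_eq0.
pose K := Phi (delta_mx j i).
have K0 a b : (a, b) != (j, i) -> K a b = 0.
  rewrite xpair_eqE negb_and => /orP[aj|bi].
    have [t /t_neq0 t0 Ea] := hE a.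
    have : Phi (delta_mx a a) *m K = 0 by apply: P0; rewrite mul_delta_mx_0.
    rewrite Ea -scalemxAl => /eqP; rewrite scaler_eq0 (negbTE t0) /=.
    move=> /eqP/matrixP/(_ a b); rewrite !mxE (bigD1 a) //= big1 => [|k ka].
      by rewrite !mxE !eqxx mul1r addr0.
    by rewrite !mxE (negbTE ka) andbF mul0r.
  have [t /t_neq0 t0 Eb] := hE b.
  have : K *m Phi (delta_mx b b) = 0.
    by apply: P0; rewrite mul_delta_mx_0 // eq_sym.
  rewrite Eb -scalemxAr => /eqP; rewrite scaler_eq0 (negbTE t0) /=.
  move=> /eqP/matrixP/(_ a b); rewrite !mxE (bigD1 b) //= big1 => [|k kb].
    by rewrite !mxE !eqxx mulr1 addr0.
  by rewrite !mxE (negbTE kb) mulr0.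
have KE : K = K j i *: delta_mx j i.
  apply/matrixP => a b; rewrite [RHS]mxE [X in _ * X]mxE.
  have [[-> ->]|ab] := eqVneq (a, b) (j, i); first by rewrite !eqxx mulr1.
  rewrite K0 //; move: ab; rewrite xpair_eqE => /negbTE -> /=.
  by rewrite mulr0.
move: (K j i) KE => k KE.
have K1 : `|k| ^+ 2 = 1.
  have [t t1 Ej] := hE j; have := P3 (delta_mx j j) _ (rE j i).
  rewrite mul_delta_mx frob_delta -/K Ej KE -scalemxAl -scalemxAr mul_delta_mx.
  by rewrite !frobZ frob_delta t1 expr1n mul1r mulr1.
have := P2 A _ (rE j i); rewrite -/K KE -scalemxAr mxtraceZ.
have trE (M : 'M[C]_n) : \tr (M *m delta_mx j i) = M i j.
  rewrite /mxtrace (bigD1 i) //= big1 => [|b bi].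
    rewrite mxE (bigD1 j) //= big1 => [|l lj]; last by rewrite mxE (negbTE lj) mulr0.
    by rewrite mxE !eqxx mulr1 !addr0.
  by rewrite mxE big1 // => l _; rewrite mxE (negbTE bi) andbF mulr0.
rewrite !trE => /(congr1 Num.norm); rewrite !normrX normrM exprMn K1 mul1r.
by move/eqP; rewrite eqrXn2 // => /eqP.
Qed.

Local Notation J := (const_mx 1 : 'M[C]_n).

Lemma trace_mul_ones (M : 'M[C]_n) : \tr (M *m J) = \sum_i \sum_j M i j.
Proof.
apply: eq_bigr => i _; rewrite mxE; apply: eq_bigr => j _.
by rewrite mxE mulr1.
Qed.

Lemma ones_outer : J = (const_mx 1 : 'cV_n) *m (const_mx 1 : 'rV_n).
Proof. by apply/matrixP => i j; rewrite !mxE big_ord1 !mxE mulr1. Qed.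

Lemma rank_outer_eq1 (u : 'cV[C]_n) (v : 'rV[C]_n) i j :
  u i 0 * v 0 j != 0 -> \rank (u *m v) = 1%N.
Proof.
move=> uv; apply/eqP; rewrite eqn_leq rank_outer_le1 lt0n mxrank_eq0.
by apply: contraNneq uv => /matrixP/(_ i j); rewrite !mxE big_ord1 => ->.
Qed.

Lemma rank_ones (i0 : 'I_n) : \rank J = 1%N.
Proof.
by rewrite ones_outer (@rank_outer_eq1 _ _ i0 i0) // !mxE mulr1 oner_eq0.
Qed.

(** The image K = uv of the all-ones matrix has unimodular entries.  As
    |tr K| = n, its diagonal is constant, equal to some w, and conjugating by the
    diagonal matrix of the entries of one column of K turns k_ij into
    k_ij k_j0 / k_i0 = u_j v_j = w. *)
Lemma align_ones Phi (i0 : 'I_n) : rank1_test_preserver Phi ->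
  (forall A i j, `|Phi A i j| = `|A i j|) ->
  exists2 D, D \is unitarymx & exists2 w : C, w ^+ 4 = 1 &
    D^t* *m Phi J *m D = w *: J /\
    forall A i j, `|(D^t* *m Phi A *m D) i j| = `|A i j|.
Proof.
move=> [P0 P1 P2 P3] hmod; pose K := Phi J.
have [u [v KE]] : exists u : 'cV_n, exists v : 'rV_n, K = u *m v.
  by apply: rank_le1_outer; rewrite P1 // (rank_ones i0).
have Kuv i j : K i j = u i 0 * v 0 j by rewrite KE mxE big_ord1.
have K1 i j : `|K i j| = 1 by rewrite hmod mxE normr1.
have n0 : (n%:R : C) != 0 by rewrite pnatr_eq0 -lt0n (leq_ltn_trans _ (ltn_ord i0)).
(* In rank one, tr K^2 = (tr K)^2. *)
have trK : (\tr K) ^+ 4 = n%:R ^+ 4.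
  have := P2 J J (rank_ones i0); rewrite -/K trace_mul_ones.
  have -> : \tr (K *m K) = \tr K ^+ 2 by rewrite KE mxtrace_outer_sqr.
  have -> : \sum_i \sum_j J i j = n%:R ^+ 2.
    under eq_bigr => i _ do under eq_bigr => j _ do rewrite mxE.
    by rewrite !sumr_const card_ord -[LHS]mulr_natr expr2.
  by rewrite -!exprM.
have /normC_sum_eq[w /eqP w1 hw] : `|\sum_i K i i| = \sum_i `|K i i|.
  under [RHS]eq_bigr => i _ do rewrite K1.
  rewrite sumr_const card_ord; apply/eqP; rewrite -(@eqrXn2 _ 4) //.
  by rewrite -normrX -/(\tr K) trK normrX normr_nat.
have Kii i : K i i = w by rewrite hw // K1 mul1r.
have unit_mod (z : C) : `|z| = 1 -> Num.conj z * z = 1.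
  by move=> z1; rewrite mulrC -normCK z1 expr1n.
pose D : 'M[C]_n := diag_mx (\row_i K i i0).
have DE A i j : (D^t* *m A *m D) i j = Num.conj (K i i0) * A i j * K j i0.
  by rewrite tr_diag_mx map_diag_mx mul_mx_diag mxE mul_diag_mx !mxE.
exists D.
  apply/unitarymxP/matrixP => i j; rewrite tr_diag_mx map_diag_mx mul_mx_diag !mxE.
  have [->|ij] := eqVneq i j; last by rewrite mulr0n mul0r.
  by rewrite !mulr1n mulrC unit_mod.
exists w.
  apply: (mulIf (expf_neq0 4 n0)); rewrite mul1r -[RHS]trK -exprMn; congr (_ ^+ 4).
  by rewrite /mxtrace (eq_bigr (fun=> w)) // sumr_const card_ord mulr_natr.
split=> [|A i j]; last by rewrite DE !normrM norm_conjC !K1 mul1r mulr1 hmod.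
apply/matrixP => i j; rewrite DE -/K [RHS]mxE [J i j]mxE mulr1.
have Ki0 : K i i0 != 0 by rewrite -normr_eq0 K1 oner_eq0.
apply: (mulfI Ki0); rewrite !mulrA [_ * Num.conj _]mulrC unit_mod // mul1r.
by rewrite -[in RHS](Kii j) !Kuv; ring.
Qed.

Lemma sum_outer_pairs (f : 'I_n -> 'I_n -> C) :
  \sum_i \sum_j f i j = \sum_p f p.1 p.2.
Proof. exact: pair_big. Qed.

(** Testing against the all-ones matrix shows that the sum of the entries of the
    image has the modulus of the sum of the entries of B, so there is equality in
    the triangle inequality and the entries of the image share one phase. *)
Lemma aligned_positive Phi (w : C) : rank1_test_preserver Phi ->
  Phi J = w *: J -> w ^+ 4 = 1 ->
  (forall A i j, `|Phi A i j| = `|A i j|) ->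
  forall B, \rank B = 1%N -> (forall i j, 0 < B i j) ->
  exists2 g : C, g ^+ 2 = 1 & Phi B = (w * g) *: B.
Proof.
move=> [P0 P1 P2 P3] hJ w4 hmod B rB Bpos.
have [i0 _|n0] := pickP (fun _ : 'I_n => true); last first.
  by exists 1; rewrite ?expr1n //; apply/matrixP => i; have := n0 i.
have w1 := expr4_eq1_norm w4.
have := P2 B J (rank_ones i0).
rewrite hJ -scalemxAr mxtraceZ !trace_mul_ones !sum_outer_pairs => E.
have sB : 0 < \sum_(p : 'I_n * 'I_n) B p.1 p.2.
  rewrite (bigD1 (i0, i0)) //= ltr_wpDr ?sumr_ge0 // => p _; exact: ltW.
have nB (p : 'I_n * 'I_n) : `|Phi B p.1 p.2| = B p.1 p.2.
  by rewrite hmod gtr0_norm.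
have /normC_sum_eq[t /eqP t1 ht] :
    `|\sum_(p : 'I_n * 'I_n) Phi B p.1 p.2| = \sum_p `|Phi B p.1 p.2|.
  rewrite (eq_bigr _ (fun p _ => nB p)); apply/eqP; rewrite -(@eqrXn2 _ 2) //.
    by rewrite -[X in _ == X]ger0_norm ?exprn_ge0 ?ltW // -E normrX normrM w1 mul1r.
  exact: ltW.
have wn : w != 0 by rewrite -normr_eq0 w1 oner_eq0.
(* (wt)^2 = 1 and w^4 = 1 give (t / w)^2 = 1. *)
exists (t / w).
  move: E; rewrite (eq_bigr (fun p : 'I_n * 'I_n => t * B p.1 p.2)) => [|p _].
    rewrite -mulr_sumr mulrA exprMn => E.
    have {}E : (w * t) ^+ 2 = 1.
      by apply: (mulIf (expf_neq0 2 (lt0r_neq0 sB))); rewrite mul1r.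
    rewrite exprMn exprVn -[RHS]E exprMn mulrC; congr (_ * _).
    apply: (mulfI (expf_neq0 2 wn)); rewrite mulfV ?expf_neq0 //.
    by rewrite -exprD w4.
  by rewrite ht // nB mulrC.
apply/matrixP => i j; rewrite mxE mulrCA divff // mulr1.
by have := ht (i, j) isT; rewrite (nB (i, j)) /= mulrC.
Qed.

Lemma rank_moment_mx (i0 : 'I_n) (t : C) : t != 0 -> \rank (moment_mx n t) = 1%N.
Proof.
move=> t0; rewrite (@rank_outer_eq1 _ _ i0 i0) // !mxE.
by rewrite mulf_neq0 ?expf_neq0.
Qed.

(** With P = Phi(A) / w, the tests against the moment matrices give
    tr((P - A) B_t) tr((P + A) B_t) = 0, with B_t = (t^(ni+j)), for all positive
    integers t. *)
Lemma aligned_scalar Phi (w : C) : rank1_test_preserver Phi ->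
  Phi J = w *: J -> w ^+ 4 = 1 ->
  (forall A i j, `|Phi A i j| = `|A i j|) ->
  forall A, exists2 g : C, signs g & Phi A = (w * g) *: A.
Proof.
move=> gP hJ w4 hmod A.
have [i0 _|n0] := pickP (fun _ : 'I_n => true); last first.
  by exists 1; [left | apply/matrixP => i; have := n0 i].
have hB (k : nat) : exists2 g : C, g ^+ 2 = 1 &
    Phi (moment_mx n k.+1%:R) = (w * g) *: moment_mx n k.+1%:R.
  apply: aligned_positive => //; first by rewrite (rank_moment_mx i0) ?pnatr_eq0.
  by move=> i j; rewrite mxE big_ord1 !mxE mulr_gt0 // exprn_gt0 // ltr0n.
have wn : w != 0 by rewrite -normr_eq0 (expr4_eq1_norm w4) oner_eq0.
have [P PE] : exists P, Phi A = w *: P.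
  by exists (w^-1 *: Phi A); rewrite scalerA divff // scale1r.
have [k||] := @moment_tests_eq0 _ n (P - A) (P + A).
- case: gP => _ _ P2 _; have [g g2 Eg] := hB k.
  rewrite mulmxBl mulmxDl raddfB raddfD /= -subr_sqr.
  apply/eqP; rewrite subr_eq0; apply/eqP.
  rewrite -[RHS]P2 ?Eg ?PE; last by rewrite (rank_moment_mx i0) ?pnatr_eq0.
  rewrite -scalemxAl -scalemxAr !mxtraceZ; set T := \tr _.
  rewrite [RHS](_ : _ = w ^+ 4 * g ^+ 2 * T ^+ 2); last by ring.
  by rewrite w4 g2 !mul1r.
- move/eqP; rewrite subr_eq0 => /eqP PA; exists 1; first by left.
  by rewrite mulr1 PE PA.
- move/eqP; rewrite addr_eq0 => /eqP PA; exists (- 1); first by right.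
  by rewrite PE PA mulrN1 scalerN scaleNr.
Qed.

Theorem rank1_test_preserver_form Phi (i0 : 'I_n) : rank1_test_preserver Phi ->
  exists2 U, U \is unitarymx & exists2 w : C, w ^+ 4 = 1 &
    forall A, exists2 g : C, signs g & Phi A = (w * g) *: (U *m A *m U^t*).
Proof.
move=> gP; have [U hU hE] := preserved_frame gP.
have gP1 := rank1_test_preserver_conj hU gP.
have hmod := preserved_moduli gP1 hE.
have [D hD [w w4 [hJ hmodD]]] := align_ones i0 gP1 hmod.
have gP2 := rank1_test_preserver_conj hD gP1.
exists (U *m D); first exact: mul_unitarymx.
exists w => // A; have [g hg E] := aligned_scalar gP2 hJ w4 hmodD A.
exists g => //; rewrite ctrmxM.
have -> : U *m D *m A *m (D^t* *m U^t*) = U *m (D *m A *m D^t*) *m U^t*.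
  by rewrite !mulmxA.
have -> : Phi A = U *m (D *m (D^t* *m (U^t* *m Phi A *m U) *m D) *m D^t*) *m U^t*.
  rewrite !mulmxA (mulmxtVK U hD) (unitarymxP hU) mul1mx.
  by rewrite (mulmxtVK _ hD) (mulmxtVK _ hU).
by rewrite E -!(scalemxAr, scalemxAl).
Qed.

End Alignment.

(** * Symmetric ranges *)

Lemma char_poly_similar (K : comNzRingType) n (P Q A : 'M[K]_n) :
  P *m Q = 1%:M -> char_poly (P *m A *m Q) = char_poly A.
Proof.
move=> PQ; pose L (M : 'M[K]_n) : 'M[{poly K}]_n := map_mx polyC M.
have LPQ : L P *m L Q = 1%:M by rewrite -map_mxM PQ map_mx1.
rewrite /char_poly.
have -> : char_poly_mx (P *m A *m Q) = L P *m char_poly_mx A *m L Q.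
  rewrite /char_poly_mx mulmxBr mulmxBl -!map_mxM; congr (_ - _).
  by rewrite mul_mx_scalar -scalemxAl LPQ scalemx1.
rewrite !det_mulmx mulrAC -det_mulmx LPQ det1 mul1r //.
Qed.

Section SymmetricRange.
Variables (R : realType) (k n : nat).
Hypothesis hn : (k <= n)%N.
Variable c : k.-tuple R.
Local Notation C := R[i].
Implicit Types A B X : 'M[C]_n.
Local Notation d := (@padded R k n c).

Lemma symmP X : symm c X <-> wrange d X = wrange d (- X).
Proof.
rewrite /symm /= !(cnumrange_padded hn) -scaleN1r wrangeZ.
suff -> : [set - z | z in wrange d X] = [set -1 * z | z in wrange d X] by [].
by apply/seteqP; split=> z [w hw <-]; exists w => //; rewrite mulN1r.
Qed.

Definition antisymmetric_weights : Prop :=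
  forall j : nat, (1 <= j <= k)%N -> coef c j + coef c (k + 1 - j) = 0.

(** Reversing an orthonormal family changes the sign of the value. *)
Lemma antisymmetric_symm : antisymmetric_weights -> forall X, symm c X.
Proof.
move=> hc X.
have sub (Y : 'M[C]_n) z : cnumrange c Y z -> cnumrange c Y (- z).
  case=> e he <-; exists (fun j => e (rev_ord j)).
    by move=> i j; rewrite he (inj_eq rev_ord_inj).
  rewrite (reindex_inj rev_ord_inj) -sumrN; apply: eq_bigr => j _.
  rewrite rev_ordK -mulNr; congr (_ * _); rewrite -rmorphN; congr (_%:C).
  apply/eqP; rewrite -addr_eq0 addrC; apply/eqP.
  have := hc j.+1; rewrite ltn_ord => /(_ isT).
  rewrite /coef /= !(tnth_nth 0) /= => E; rewrite -[RHS]E.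
  by rewrite addn1 subSS -subnS addrC.
rewrite /symm /=; apply/seteqP; split=> z.
  by move=> /sub hz; exists (- z) => //; rewrite opprK.
by case=> w /sub hw <-.
Qed.

Lemma padded_seq : [seq d i | i : 'I_n] = c ++ nseq (n - k) 0.
Proof.
apply: (@eq_from_nth _ 0).
  by rewrite size_map size_enum_ord size_cat size_tuple size_nseq subnKC.
move=> i; rewrite size_map size_enum_ord => i_n.
rewrite (nth_map (Ordinal i_n)) ?size_enum_ord // /padded nth_enum_ord //.
rewrite nth_cat size_tuple nth_nseq; case: ltnP => // ki.
by rewrite nth_default ?size_tuple // if_same.
Qed.

Hypothesis c_sorted : sorted >=%R c.

Lemma perm_opp_antisymmetric : perm_eq c (map -%R c) -> antisymmetric_weights.
Proof.
move=> pc j /andP[j1 jk].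
have E : (c : seq R) = rev (map -%R c).
  apply: (sorted_eq (leT := >=%R)) => //.
  - exact: ge_trans.
  - exact: ge_anti.
  - rewrite rev_sorted sorted_map; apply: sub_sorted c_sorted => x y /=.
    by rewrite lerN2.
  by rewrite perm_sym perm_rev perm_sym.
rewrite /coef {1}E nth_rev ?size_map ?size_tuple; last by rewrite prednK.
rewrite (nth_map 0) ?size_tuple; last by rewrite ltn_subrL /= (leq_trans j1).
rewrite prednK // (_ : (k + 1 - j).-1 = k - j)%N ?addNr //.
by rewrite addn1 subSn.
Qed.

(** The range of X = diag(d) contains tr X^2.  If it contains - tr X^2 too, say
    at Y = V X V^*, then X + Y has Frobenius norm zero, so X and -X are unitarily
    similar, and comparing characteristic polynomials the d_i are the - d_i up to
    order. *)
Lemma symm_diag_antisymmetric :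
  symm c (diag_mx (\row_i (d i)%:C)) -> antisymmetric_weights.
Proof.
set X := diag_mx _ => /symmP E.
have XE i j : X i j = (d i)%:C *+ (i == j) by rewrite !mxE.
clearbody X.
have XX : \tr (X *m X) = wtrace d X.
  apply: eq_bigr => i _; rewrite mxE (bigD1 i) //= big1 => [|j ji].
    by rewrite addr0 XE eqxx mulr1n.
  by rewrite XE eq_sym (negbTE ji) mul0r.
have : wrange d X (wtrace d X).
  exists 1%:M; last by rewrite trmx1 map_mx1 mulmx1 mul1mx.
  by apply/unitarymxP; rewrite trmx1 map_mx1 mulmx1.
rewrite E => -[V /= hV hW].
pose Y := V *m X *m V^t*.
have XY : \tr (X *m Y) = - \tr (X *m X).
  rewrite XX -hW mulmxN mulNmx -/Y /wtrace -sumrN; apply: eq_bigr => i _.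
  rewrite [(- Y) i i]mxE mulrN opprK mxE (bigD1 i) //= big1 => [|j ji].
    by rewrite addr0 XE eqxx mulr1n.
  by rewrite XE eq_sym (negbTE ji) mul0r.
have Xh : X^t* = X.
  apply/matrixP => i j; rewrite mxE [_^T _ _]mxE !XE eq_sym.
  by have [->|_] := eqVneq i j; rewrite ?mulr0n ?conjC0 //= !mulr1n; apply: conjc_real.
have Yh : Y^t* = Y by rewrite !ctrmxM trmxCK Xh mulmxA.
have YY : \tr (Y *m Y) = \tr (X *m X).
  have -> : Y *m Y = V *m (X *m X) *m V^t*.
    exact: conj_mulmx.
  exact: mxtrace_conj.
have YX : Y = - X.
  apply/eqP; rewrite -addr_eq0; apply/eqP; apply: frob_eq0.
  rewrite /frob ctrmxD Xh Yh mulmxDl !mulmxDr !mxtraceD YY (mxtrace_mulC Y X) XY.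
  by rewrite addrN add0r addNr.
apply: perm_opp_antisymmetric; rewrite -(perm_cat2r (nseq (n - k) 0)).
have -> : map -%R c ++ nseq (n - k) 0 = map -%R (c ++ nseq (n - k) 0).
  by rewrite map_cat map_nseq oppr0.
rewrite -padded_seq -map_comp.
apply: (perm_map_inj (@complexI R)); apply: prod_XsubC_eq.
rewrite !big_map -!enumT !big_enum /=.
have diagP (s : C) : char_poly (s *: X) = \prod_i ('X - (s * (d i)%:C)%:P).
  rewrite char_poly_trig.
    by apply: eq_bigr => i _; rewrite mxE XE eqxx mulr1n.
  by apply/is_trig_mxP => i j ij; rewrite mxE XE -val_eqE ltn_eqF // mulr0.
have := char_poly_similar X (unitarymxP hV); rewrite -/Y YX -scaleN1r diagP.
rewrite -[X in _ = char_poly X]scale1r diagP => P.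
transitivity (\prod_i ('X - (1 * (d i)%:C)%:P)).
  by apply: eq_bigr => i _; rewrite mul1r.
by rewrite -P; apply: eq_bigr => i _; congr ('X - _%:P); rewrite mulN1r -rmorphN.
Qed.

Lemma coef_bounds x : x \in c -> coef c k <= x <= coef c 1.
Proof.
move=> /(nthP 0)[j]; rewrite size_tuple => jk <-.
have k0 : (0 < k)%N by apply: leq_ltn_trans jk.
have mono a b : (a <= b)%N -> (b < k)%N -> nth 0 c b <= nth 0 c a.
  move=> ab bk; apply: (sorted_leq_nth ge_trans ge_refl 0 c_sorted) => //.
    by rewrite inE size_tuple (leq_ltn_trans ab).
  by rewrite inE size_tuple.
by apply/andP; split; apply: mono; rewrite // -ltnS prednK.
Qed.

Hypothesis c_nonconst : ~~ constant c.

(** If d_max + d_min = 0 then d_max > 0 > d_min, so both are genuine entries of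
    c, hence equal to c_1 and c_k. *)
Lemma extremal_weights : exists i0 i1 : 'I_n,
  [/\ forall i, d i1 <= d i <= d i0, d i1 < d i0 &
      coef c 1 + coef c k != 0 -> d i0 + d i1 != 0].
Proof.
have k0 : (0 < k)%N.
  by case: k c c_nonconst => // c0; rewrite (tuple0 c0).
have n0 : (0 < n)%N := leq_trans k0 hn.
case: (@arg_maxP _ R 'I_n (Ordinal n0) xpredT d) => // i0 _ h0.
case: (@arg_minP _ R 'I_n (Ordinal n0) xpredT d) => // i1 _ h1.
have dd i : d i1 <= d i <= d i0.
  by apply/andP; split; [apply: h1 | apply: h0].
have cd x : x \in c -> exists i, x = d i.
  move=> /(nthP 0)[j]; rewrite size_tuple => jk <-.
  by exists (widen_ord hn (Ordinal jk)).
have lt01 : d i1 < d i0.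
  rewrite lt_neqAle; case/andP: (dd i0) => -> _; rewrite andbT.
  apply: contraNneq c_nonconst => E; apply: (@all_pred1_constant _ (d i0)).
  apply/allP => x /cd[i ->] /=; apply/eqP/le_anti.
  by have := dd i; rewrite E andbC.
exists i0, i1; split=> // hc; apply: contraNneq hc => dE.
have dmem i : d i != 0 -> d i \in (c : seq R).
  move=> di; rewrite mem_nth // ltnNge; apply: contraNN di => /= ki.
  by rewrite /padded nth_default.
have m0 : d i0 \in (c : seq R) by apply: dmem; apply/eqP; lra.
have m1 : d i1 \in (c : seq R) by apply: dmem; apply/eqP; lra.
have c1 : coef c 1 \in (c : seq R) by rewrite mem_nth ?size_tuple.
have ck : coef c k \in (c : seq R) by rewrite mem_nth ?size_tuple ?prednK.
have /andP[_ b0] := coef_bounds m0; have /andP[b1 _] := coef_bounds m1.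
have [i Ei] := cd _ c1; have [j Ej] := cd _ ck.
have /andP[_ b2] := dd i; have /andP[b3 _] := dd j.
apply/eqP; rewrite Ei Ej in b0 b1 *; lra.
Qed.

End SymmetricRange.

(** * Maps preserving the ranges of products *)

Section Preservers.
Variables (R : realType) (k n : nat).
Hypotheses (hk : (2 <= k)%N) (hn : (k <= n)%N).
Variable c : k.-tuple R.
Hypotheses (c_sorted : sorted >=%R c) (c_nonconst : ~~ constant c).
Local Notation C := R[i].
Implicit Types A B X U : 'M[C]_n.
Local Notation d := (@padded R k n c).

Lemma signs_sqr (g : C) : signs g -> g ^+ 2 = 1.
Proof. by case=> ->; rewrite ?sqrrN expr1n. Qed.

Lemma sqr_signs (g : C) : g ^+ 2 = 1 -> signs g.
Proof.
by move/eqP; rewrite -subr_eq0 subr_sqr_1 mulf_eq0 subr_eq0 addr_eq0;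
  case/orP => /eqP; [left | right].
Qed.

Lemma signsM (g h : C) : signs g -> signs h -> signs (g * h).
Proof.
by move=> /signs_sqr g2 /signs_sqr h2; apply: sqr_signs; rewrite exprMn g2 h2 mulr1.
Qed.

Lemma mul_conj a b U A B : U \is unitarymx ->
  (a *: (U *m A *m U^t*)) *m (b *: (U *m B *m U^t*)) =
  (a * b) *: (U *m (A *m B) *m U^t*).
Proof.
move=> hU; rewrite -scalemxAl -scalemxAr scalerA; congr (_ *: _).
exact: conj_mulmx.
Qed.

(** Only a sign on a matrix with nonsymmetric range can be seen. *)
Lemma cnumrange_sign_conj s U X : U \is unitarymx -> signs s ->
  (~ symm c X -> s = 1) ->
  cnumrange c (s *: (U *m X *m U^t*)) = cnumrange c X.
Proof.
move=> hU hs hX; rewrite !(cnumrange_padded hn) scalemxAl scalemxAr (wrange_conj _ _ hU).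
have [/(symmP hn) E|/hX ->] := pselect (symm c X); last by rewrite scale1r.
case: hs => ->; first by rewrite scale1r.
by rewrite scaleN1r -E.
Qed.

Section Converse.
Variable Phi : 'M[C]_n -> 'M[C]_n.

Lemma form_i_preserves : form_i Phi ->
  forall A B, cnumrange c (Phi A *m Phi B) = cnumrange c (A *m B).
Proof.
case=> U [eps [hU heps hPhi]] A B; rewrite !hPhi (mul_conj _ _ _ _ hU).
apply: (cnumrange_sign_conj hU); first exact: signsM.
by move=> _; rewrite -expr2 signs_sqr.
Qed.

Lemma form_ii_preserves : form_ii c Phi ->
  forall A B, cnumrange c (Phi A *m Phi B) = cnumrange c (A *m B).
Proof.
case=> U [phi [phi' [eps [hU [hphi hphi' heps] hsgn hoff hPhi]]]].
have val A : exists2 g : C, signs g &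
    Phi A = g *: (U *m A *m U^t*) /\ (~ symm_mul c A -> g = phi' A).
  have [T NT Off] := hPhi A.
  have [/[dup] hT /T E|nT] := pselect (symm_mul c A).
    by exists (phi A); [exact: hphi | split].
  exists (phi' A); first exact: hphi'.
  split=> //; have [/NT|/[dup] nS /Off] := pselect (symm c A); first exact.
  by rewrite hoff.
move=> A B; have [g hg [-> gA]] := val A; have [h hh [-> hB]] := val B.
rewrite (mul_conj _ _ _ _ hU); apply: (cnumrange_sign_conj hU) => [|nAB].
  exact: signsM.
have nTA : ~ symm_mul c A by case=> _ /(_ B)[AB _]; exact: (nAB AB).
have nTB : ~ symm_mul c B by case=> _ /(_ A)[_ AB]; exact: (nAB AB).
rewrite (gA nTA) (hB nTB).
by have := hsgn A B; rewrite /sgn memNset.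
Qed.

Lemma form_iii_preserves : antisymmetric_weights c -> form_iii Phi ->
  forall A B, cnumrange c (Phi A *m Phi B) = cnumrange c (A *m B).
Proof.
move=> hc [U [g [hU hg H]]] A B.
have ns X : ~ symm c X -> False by apply; apply: antisymmetric_symm.
case: H => hPhi; rewrite !hPhi (mul_conj _ _ _ _ hU);
  apply: (cnumrange_sign_conj hU).
- exact: signsM.
- by move/ns.
- rewrite mulrACA -[_ * 'i]/('i%R ^+ 2) sqrCi mulN1r; apply: sqr_signs.
  by rewrite sqrrN exprMn !signs_sqr ?mulr1.
- by move/ns.
Qed.

End Converse.

Variable Phi : 'M[C]_n -> 'M[C]_n.
Hypothesis Phi_surj : forall B, exists A, Phi A = B.
Hypothesis Phi_range :
  forall A B, cnumrange c (Phi A *m Phi B) = cnumrange c (A *m B).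

Lemma range_preserver_form : exists U, exists w : C, exists g : 'M[C]_n -> C,
  [/\ U \is unitarymx, signs (w ^+ 2), forall A, signs (g A) &
      forall A, Phi A = (w * g A) *: (U *m A *m U^t*)].
Proof.
have n1 : (1 < n)%N := leq_trans hk hn.
have [i0 [i1 [d_le d_lt _]]] := extremal_weights hn c_sorted c_nonconst.
have W A B : wrange d (Phi A *m Phi B) = wrange d (A *m B).
  by rewrite -!(cnumrange_padded hn) Phi_range.
have d01 : d i0 != d i1 by rewrite gt_eqF.
have Sc A B : is_scalar_mx (Phi A *m Phi B) = is_scalar_mx (A *m B).
  by apply/is_scalar_mxP/is_scalar_mxP; rewrite -!(wrange_subsingleton d01) W.
have P1 := preserver_rank1 n1 Phi_surj Sc.
have rk A B : \rank B = 1%N -> (\rank (A *m B) <= 1)%N.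
  by move=> <-; apply: mxrankM_maxr.
have inv A B : \rank B = 1%N -> \tr (Phi A *m Phi B) ^+ 2 = \tr (A *m B) ^+ 2 /\
    frob (Phi A *m Phi B) = frob (A *m B).
  move=> rB; apply: (wrange_eq_invariants d_le d_lt) => //; apply: rk => //.
  exact: P1.
have gP : rank1_test_preserver Phi.
  split=> // [A B|A B rB|A B rB]; first by rewrite (preserver_mul_eq0 n1).
    by case: (inv A B rB).
  by case: (inv A B rB).
have [U hU [w w4 hw]] := rank1_test_preserver_form i0 gP.
have /choice[g hg] : forall A, exists s : C,
    signs s /\ Phi A = (w * s) *: (U *m A *m U^t*).
  by move=> A; have [s ? ?] := hw A; exists s.
exists U, w, g; split=> //.
- by apply: sqr_signs; rewrite -exprM.
- by move=> A; case: (hg A).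
- by move=> A; case: (hg A).
Qed.

Section Shape.
Variables (U : 'M[C]_n) (w : C) (g : 'M[C]_n -> C).
Hypotheses (hU : U \is unitarymx) (w2 : signs (w ^+ 2)) (hg : forall A, signs (g A)).
Hypothesis hPhi : forall A, Phi A = (w * g A) *: (U *m A *m U^t*).

(** The other value -1 would make the range of AB equal to that of -AB. *)
Lemma sign_of_nonsymm A B : ~ symm c (A *m B) -> w ^+ 2 * (g A * g B) = 1.
Proof.
move=> nAB; have : signs (w ^+ 2 * (g A * g B)) by do 2!apply: signsM => //.
case=> // E; case: nAB; apply/(symmP hn).
have := Phi_range A B; rewrite !hPhi (mul_conj _ _ _ _ hU) !(cnumrange_padded hn).
rewrite mulrACA -expr2 E scalemxAl scalemxAr (wrange_conj _ _ hU) scaleN1r.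
exact: esym.
Qed.

Lemma signs_mul_self (s : C) : signs s -> s * s = 1.
Proof. by rewrite -expr2; apply: signs_sqr. Qed.

(** For A <> 0 there is a rank one B such that B and AB both have nonzero trace;
    as their ranges are not symmetric, g(A) = g(1). *)
Lemma range_preserver_form_i : coef c 1 + coef c k != 0 -> form_i Phi.
Proof.
move=> hc; have [i0 [i1 [d_le d_lt /(_ hc) d0]]] := extremal_weights hn c_sorted c_nonconst.
have n0 : (0 < n)%N := leq_ltn_trans (leq0n _) (ltn_ord i0).
have one_neq0 : (1%:M : 'M[C]_n) <> 0.
  by move=> /matrixP/(_ i0 i0)/eqP; rewrite !mxE eqxx oner_eq0.
have step A : A <> 0 -> exists B, [/\ B <> 0,
    w ^+ 2 * (g A * g B) = 1 & w ^+ 2 * (g 1%:M * g B) = 1].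
  move=> A0; have [t ht] : exists t, \tr (A *m moment_mx n t.+1%:R) *
       \tr (1%:M *m moment_mx n t.+1%:R) != 0.
    apply: contrapT => h; case: (@moment_tests_eq0 C n A 1%:M) => // t.
    by apply/eqP/negPn/negP => ht; apply: h; exists t.
  pose B : 'M[C]_n := moment_mx n t.+1%:R; rewrite -/B in ht.
  have rB : (\rank B <= 1)%N by apply: rank_outer_le1.
  have nS X : \tr (X *m B) != 0 -> ~ symm c (X *m B).
    move=> trX /(symmP hn) E; move/eqP: trX; apply.
    apply: (symmetric_rank1_trace0 d_le d_lt d0) E.
    exact: leq_trans (mxrankM_maxr _ _) rB.
  move: ht; rewrite mulf_eq0 negb_or => /andP[/nS trA tr1].
  exists B; split; [|exact: sign_of_nonsymm|exact/sign_of_nonsymm/nS].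
  by move=> B0; move: tr1; rewrite B0 mulmx0 mxtrace0 eqxx.
have s_neq0 (s : C) : signs s -> s != 0.
  by case=> ->; rewrite ?oppr_eq0 oner_eq0.
have gE A : A <> 0 -> g A = g 1%:M.
  move=> /step[B [_ E1 E2]]; apply: (mulfI (s_neq0 _ w2)).
  apply: (mulIf (s_neq0 _ (hg B))).
  by rewrite -(mulrA _ (g A)) -(mulrA _ (g 1%:M)) E1 E2.
have ww : w ^+ 2 = 1.
  have [B [/gE gB E1 _]] := step _ one_neq0.
  by move: E1; rewrite gB signs_mul_self // mulr1.
exists U, (w * g 1%:M); split=> [//||A]; first by apply: signsM => //; apply: sqr_signs.
rewrite hPhi; have [->|/eqP/gE -> //] := eqVneq A 0.
by rewrite mulmx0 mul0mx !scaler0.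
Qed.

(** diag(d) is the square of the diagonal matrix D of complex square roots and
    has a nonsymmetric range, so w^2 g(D)^2 = 1.  The signs w g(A) serve as both
    sign functions; off the symmetric matrices they take the value at 1, because
    A = A 1. *)
Lemma range_preserver_form_ii : ~ antisymmetric_weights c -> form_ii c Phi.
Proof.
move=> hc; pose D : 'M[C]_n := diag_mx (\row_i sqrtc (d i)%:C).
have ww : w ^+ 2 = 1.
  have : ~ symm c (D *m D).
    have -> : D *m D = diag_mx (\row_i (d i)%:C).
      rewrite mulmx_diag; congr diag_mx; apply/rowP => i.
      by rewrite !mxE -expr2 sqr_sqrtc.
    by move=> /(symm_diag_antisymmetric hn c_sorted).
  by move/sign_of_nonsymm; rewrite signs_mul_self // mulr1.
pose h A := w * g A.
have hh A : signs (h A) by apply: signsM => //; apply: sqr_signs.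
have hmul A B : ~ symm c (A *m B) -> h A * h B = 1.
  by move/sign_of_nonsymm => <-; rewrite /h; ring.
have hoff A : ~ symm c A -> h A = h 1%:M.
  have := hmul A 1%:M; rewrite mulmx1 => E /E {}E.
  by rewrite -[LHS]mulr1 -[X in _ * X](signs_mul_self (hh 1%:M)) mulrA E mul1r.
exists U, h, h, (h 1%:M); split=> // [A B|A].
  rewrite /sgn; case: ifPn => [_|/negP AB]; first exact: signsM.
  by apply: hmul => S; apply: AB; exact: mem_set.
by split=> [_|_ _|/hoff <-]; apply: hPhi.
Qed.

Lemma range_preserver_form_iii : form_iii Phi.
Proof.
case: w2 => E.
  exists U, (fun A => w * g A); split=> // [A|]; last by left.
  by apply: signsM => //; apply: sqr_signs.
have hi : 'i * (- 'i * w) = w by rewrite mulrA mulrN -expr2 sqrCi opprK mul1r.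
exists U, (fun A => (- 'i * w) * g A); split=> // [A|].
  apply: signsM => //; apply: sqr_signs.
  by rewrite exprMn sqrrN sqrCi E mulrNN mulr1.
by right=> A; rewrite mulrA hi.
Qed.

End Shape.

End Preservers.

Theorem theorem1p1 (R : realType) (k n : nat) (hk : (2 <= k)%N) (hn : (k <= n)%N)
    (c : k.-tuple R) (c_sorted : sorted >=%R c) (c_nonconst : ~~ constant c)
    (Phi : 'M[R[i]]_n -> 'M[R[i]]_n) (Phi_surj : forall B, exists A, Phi A = B) :
  (forall A B, cnumrange c (Phi A *m Phi B) = cnumrange c (A *m B)) <->
  [\/ coef c 1 + coef c k != 0 /\ form_i Phi,
      (exists p : nat, [/\ (1 < p < k)%N,
           coef c p + coef c (k + 1 - p) != 0 &
           forall j : nat, (1 <= j <= p - 1)%N ->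
             coef c j + coef c (k + 1 - j) = 0]) /\ form_ii c Phi |
      (forall j : nat, (1 <= j <= k)%N ->
         coef c j + coef c (k + 1 - j) = 0) /\ form_iii Phi].
Proof.
split=> [Phi_range|[[_]|[_]|[]]]; last 3 first.
- exact: form_i_preserves.
- exact: form_ii_preserves.
- exact: form_iii_preserves.
have [U [w [g [hU w2 hg hPhi]]]] :=
  range_preserver_form hk hn c_sorted c_nonconst Phi_surj Phi_range.
have [hc|hc] := boolP (coef c 1 + coef c k != 0).
  apply: Or31; split=> //.
  exact: (range_preserver_form_i hn c_sorted c_nonconst Phi_range hU w2 hg hPhi).
have [anti|nanti] := pselect (antisymmetric_weights c).
  by apply: Or33; split=> //; apply: range_preserver_form_iii hU w2 hg hPhi.
apply: Or32; split; last first.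
  exact: (range_preserver_form_ii hn c_sorted Phi_range hU w2 hg hPhi).
(* The least p at which antisymmetry fails; failure at k would be failure at 1. *)
pose bad p := (1 <= p <= k)%N && (coef c p + coef c (k + 1 - p) != 0).
have ex_bad : exists p, bad p.
  apply: contrapT => h; apply: nanti => j hj; apply/eqP/negPn/negP => hj'.
  by apply: h; exists j; rewrite /bad hj.
case: (ex_minnP ex_bad) => p /andP[/andP[p1 pk] hp] hmin.
have p_neq1 : p != 1%N by apply: contraNneq hc => p1'; move: hp; rewrite p1' addnK.
have p_neqk : p != k.
  by apply: contraNneq hc => pk'; move: hp; rewrite pk' addKn addrC.
exists p; split=> //.
  by rewrite (ltn_neqAle 1) (ltn_neqAle p) eq_sym p_neq1 p1 p_neqk.
move=> j /andP[j1 jp]; apply/eqP/negPn/negP => hj.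
have jp' : (j < p)%N by rewrite -(subnK p1) addn1 ltnS.
have := hmin j; rewrite /bad j1 (leq_trans (ltnW jp') pk) hj => /(_ isT).
by rewrite leqNgt jp'.
Qed.
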